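(* Suppose $X_j=T_j(Z_j)$, $1\le j\le p$, for a pairwise Gaussian vector $(Z_1,\ldots,Z_p)$ with correlation matrix $\mathrm{Corr}(Z_1,\ldots,Z_p)=\Sigma^z$ and some deterministic functions $T_j$ with $0<\mathrm{Var}(T_j(Z_j))<\infty$. Then $$\lambda_{\min}(\Sigma^z)\sum_{i=1}^p\|\widehat f_i-f_i\|^2_{L_2^{(0)}(\mathbb P)}\le\Big\|\sum_{i=1}^p\widehat f_i-\sum_{i=1}^pf_i\Big\|^2_{L_2^{(0)}(\mathbb P)}\le\lambda_{\max}(\Sigma^z)\sum_{i=1}^p\|\widehat f_i-f_i\|^2_{L_2^{(0)}(\mathbb P)}.$$
   Context: A random vector $(Z_1,\ldots,Z_p)$ is pairwise Gaussian if $(Z_j,Z_k)$ is bivariate Gaussian for all pairs $(j,k)$. $\|f\|_{L_2^{(0)}(\mathbb P)}$ is the semi-norm with $\|f\|^2_{L_2^{(0)}(\mathbb P)}=\mathrm{Var}(f(X_1,\ldots,X_p))$. Here $f_i$ and $\widehat f_i$ are functions of the $i$-th coordinate $X_i$ with $\mathrm{Var}(f_i(X_i))<\infty$ and $\mathrm{Var}(\widehat f_i(X_i))<\infty$ ($f_i$ the components of an additive model and $\widehat f_i$ their estimates; in the norms $\widehat f_i$ is treated as a fixed function, the variance being over $(X_1,\ldots,X_p)$). $\lambda_{\min},\lambda_{\max}$ are the smallest and largest eigenvalues. *)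

(* Defs.v *)
From HB Require Import structures.
From mathcomp Require Import all_boot all_order all_algebra.
From mathcomp Require Import all_classical all_reals all_analysis.

Set Implicit Arguments.
Unset Strict Implicit.
Unset Printing Implicit Defensive.

Import Order.TTheory GRing.Theory Num.Theory.
Import numFieldNormedType.Exports.

Local Open Scope classical_set_scope.
Local Open Scope ring_scope.
Local Open Scope ereal_scope.

(* The joint law of (X, Y) is that of m + A N with N standard Gaussian in the
   plane. A is an arbitrary 2 x 2 matrix: degenerate Gaussian laws are allowed,
   e.g. the one of a pair with correlation 1 or -1. *)
Definition bivariate_gaussian (d : measure_display) (Omega : measurableType d)
    (R : realType) (P : probability Omega R) (X Y : Omega -> R) : Prop :=
  exists m1 m2 a11 a12 a21 a22 : R,
    forall B : set (R * R), measurable B ->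
      pushforward P (fun w => (X w, Y w)) B =
      pushforward (normal_prob (0 : R) (1 : R) \x normal_prob (0 : R) (1 : R))
        (fun z : R * R =>
           ((m1 + a11 * z.1 + a12 * z.2)%R, (m2 + a21 * z.1 + a22 * z.2)%R)) B.

Definition pairwise_gaussian (d : measure_display) (Omega : measurableType d)
    (R : realType) (P : probability Omega R) (p : nat)
    (Z : 'I_p -> Omega -> R) : Prop :=
  forall j k : 'I_p, bivariate_gaussian P (Z j) (Z k).

Definition correlation (d : measure_display) (Omega : measurableType d)
    (R : realType) (P : probability Omega R) (X Y : Omega -> R) : R :=
  (fine (covariance P X Y) /
     (Num.sqrt (fine 'V_P[X]) * Num.sqrt (fine 'V_P[Y])))%R.

Definition correlation_mx (d : measure_display) (Omega : measurableType d)
    (R : realType) (P : probability Omega R) (p : nat)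
    (Z : 'I_p -> Omega -> R) : 'M[R]_p :=
  \matrix_(j, k) correlation P (Z j) (Z k).

(* A matrix has finitely many eigenvalues, and a real symmetric one of positive
   size has at least one: inf and sup are then a minimum and a maximum. *)
Definition lambda_min (R : realType) (p : nat) (A : 'M[R]_p) : R :=
  inf [set a : R | eigenvalue A a].

Definition lambda_max (R : realType) (p : nat) (A : 'M[R]_p) : R :=
  sup [set a : R | eigenvalue A a].

(* Extended-real valued, hence +oo when f(X_1, ..., X_p) has no finite second
   moment. *)
Definition L20_seminorm (d : measure_display) (Omega : measurableType d)
    (R : realType) (P : probability Omega R) (p : nat)
    (X : 'I_p -> Omega -> R) (f : ('I_p -> R) -> R) : \bar R :=
  sqrte 'V_P[fun w => f (fun i => X i w)].

(* Main.v *)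
(** Put g i = (fhat i - f i) o T i, so that both sides are quadratic in the
    covariances of the g i (Z i). For cosines of Gaussian variables,
    cov (cos (c + s X)) (cos (e + t Y)) is a power series in the correlation r of
    X and Y without constant term, whose k-th term is r^k / k! times the product
    of a number depending on (c, s) by a number depending on (e, t). Hence, when
    each g i is a trigonometric polynomial,
      a sum_i Var (g i (Z i)) + b Var (sum_i g i (Z i))
    is a series over k >= 1, with positive weights, of values of the quadratic
    forms of a I + b S^(ok), where S^(ok) is the k-th Hadamard power of the
    correlation matrix S. As S has a unit diagonal, a I + b S^(ok) is the Hadamard
    product of a I + b S with k - 1 copies of S, so it is positive semidefinite
    as soon as a I + b S is (Schur). Trigonometric polynomials are dense in L^2 of
    any law on the line, so the inequality holds for all g i of finite variance;
    (a, b) = (- lambda_min, 1) and (lambda_max, -1) give the two bounds. *)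

Require Import Defs.
From HB Require Import structures.
From mathcomp Require Import all_boot all_order all_algebra.
From mathcomp Require Import all_classical all_reals all_analysis.
From mathcomp Require Import measurable_realfun ring lra.

Set Implicit Arguments.
Unset Strict Implicit.
Unset Printing Implicit Defensive.

Import Order.TTheory GRing.Theory Num.Theory.
Import numFieldNormedType.Exports.

Local Open Scope classical_set_scope.
Local Open Scope ring_scope.

(** * Moments and characteristic function of the standard Gaussian law *)

Section normal_prob_integral.
Local Open Scope ereal_scope.
Context {R : realType}.
Notation mu := (@lebesgue_measure R).
Notation gam := (normal_prob (0 : R) (1 : R)).
Notation phi := (normal_pdf (0 : R) (1 : R)).

(** Cosines replace Hermite polynomials because a product of two cosines is a half-sum of cosines of
    linear combinations: a covariance is then read off from the characteristic function of one pair.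
    Only laws of pairs enter, so pairwise Gaussianity is enough, and the Schur step asks of [S] only
    that it be a Gram matrix. The unit diagonal of [S] requires every [Z i] to have positive
    variance. This is extracted from the positive variance of [T i \o Z i]: a function of an almost
    surely constant variable is almost surely constant. The density statement is for an arbitrary
    law and rests on dominated convergence alone. Polynomials in a sine sharpen into the indicator
    of the set where the sine is positive; stretching the period gives half-lines, and these
    generate the Borel sets. The Gaussian characteristic function is obtained as the solution of
    [F' = - s F], an equation that integration by parts against the density provides. *)

Lemma ge0_integral_normal_prob (f : R -> R) :
  measurable_fun setT f -> (forall x, 0 <= f x)%R ->
  \int[gam]_x (f x)%:E = \int[mu]_x (f x * phi x)%:E.
Proof.
move=> mf f0; have dom := @normal_prob_dominates R 0 1.
have f0' x : 0 <= (EFin \o f) x by rewrite lee_fin.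
have mf' : measurable_fun setT (EFin \o f) by exact/measurable_EFinP.
rewrite -(Radon_Nikodym_SigmaFinite.change_of_variables dom f0' measurableT mf').
have iRN := Radon_Nikodym_SigmaFinite.f_integrable dom.
under [RHS]eq_integral do rewrite EFinM.
have mphi : measurable_fun setT (EFin \o phi).
  by apply/measurable_EFinP; exact: measurable_normal_pdf.
apply: ae_eq_integral => //.
- by apply: emeasurable_funM; [exact/measurable_EFinP|exact: measurable_int iRN].
- by apply: emeasurable_funM => //; exact/measurable_EFinP.
(* The Radon-Nikodym derivative is known only through its integrals over measurable sets; [phi] has
   the same ones, so the two agree almost everywhere. *)
- apply: ae_eqe_mul2l; apply: integral_ae_eq => // E _ mE.
  by rewrite -Radon_Nikodym_SigmaFinite.f_integral.
Qed.

Lemma normal_pdf01E x : phi x = (normal_peak 1 * expR (- x ^+ 2 / 2))%R.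
Proof.
by rewrite normal_pdfE ?oner_eq0// /normal_fun subr0 expr1n.
Qed.

(** Half of the Gaussian decay absorbs the quadratic factor: [(1 + x ^+ 2) * expR (- x ^+ 2 / 4)] is
    at most 4, and the other half is, up to a constant, the density of variance 2. *)
Lemma quadratic_growth_integrable (h : R -> R) (C : R) :
  measurable_fun setT h -> (forall x, `|h x| <= C * (1 + x ^+ 2))%R ->
  mu.-integrable setT (EFin \o (fun x => h x * phi x)%R).
Proof.
move=> mh hC.
have C0 : (0 <= C)%R.
  by have := hC 0%R; rewrite expr0n addr0 mulr1; exact: le_trans.
pose s : R := Num.sqrt 2.
have s0 : s != 0%R by rewrite sqrtr_eq0 -ltNge.
have s2 : (s ^+ 2 = 2)%R by rewrite sqr_sqrtr.
have ps0 := normal_peak_gt0 s0.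
have iK := @integrable_normal_pdf R 0 s.
have mphi : measurable_fun setT phi by exact: measurable_normal_pdf.
(* The 4 bounds [(1 + x ^+ 2) * expR (- x ^+ 2 / 4)]; the quotient of the peaks converts between the
   normalizations of variance 1 and variance 2. *)
pose K : R := (C * 4 * normal_peak 1 / normal_peak s)%R.
apply: (@le_integrable _ _ _ mu _ measurableT _
    (fun x => K%:E * (normal_pdf 0 s x)%:E)) => //.
- by apply/measurable_EFinP; exact: measurable_funM.
- move=> x _; rewrite /= lee_fin normrM (ger0_norm (normal_pdf_ge0 _ _ _)).
  rewrite normrM (ger0_norm (normal_pdf_ge0 _ _ _)).
  have K0 : (0 <= K)%R.
    by rewrite /K !mulr_ge0 ?invr_ge0 ?normal_peak_ge0.
  rewrite (ger0_norm K0) normal_pdf01E normal_pdfE// /normal_fun subr0 s2.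
  have -> : (K * (normal_peak s * expR (- x ^+ 2 / (2 *+ 2))) =
      C * 4 * normal_peak 1 * expR (- x ^+ 2 / (2 *+ 2)))%R.
    by rewrite /K; field; rewrite gt_eqF.
  apply: (@le_trans _ _ (C * (1 + x ^+ 2) *
      (normal_peak 1 * expR (- x ^+ 2 / 2))))%R.
    by rewrite ler_wpM2r// mulr_ge0 ?normal_peak_ge0 ?expR_ge0.
  have -> : (- x ^+ 2 / 2 = - x ^+ 2 / (2 *+ 2) + - (x ^+ 2 / 4))%R by field.
  rewrite expRD.
  set e1 := expR (- x ^+ 2 / _).
  rewrite [leLHS](_ : _ = C * normal_peak 1 * e1 *
     ((1 + x ^+ 2) * expR (- (x ^+ 2 / 4))))%R; last by ring.
  rewrite [leRHS](_ : _ = C * normal_peak 1 * e1 * 4)%R; last by ring.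
  rewrite ler_wpM2l// ?mulr_ge0 ?normal_peak_ge0 ?expR_ge0//.
  rewrite expRN ler_pdivrMr ?expR_gt0//.
  have := expR_ge1Dx (x ^+ 2 / 4)%R.
  by have := sqr_ge0 x; lra.
- exact: integrableZl.
Qed.

Lemma integrable_normal_prob (h : R -> R) (C : R) :
  measurable_fun setT h -> (forall x, `|h x| <= C * (1 + x ^+ 2))%R ->
  gam.-integrable setT (EFin \o h).
Proof.
move=> mh hC; apply/integrableP; split; first exact/measurable_EFinP.
have /integrableP[_] := quadratic_growth_integrable mh hC.
under eq_integral do
  rewrite /= normrM [X in (_ * X)%R]ger0_norm ?normal_pdf_ge0//.
have mnh : measurable_fun setT (Num.norm \o h) by exact: measurableT_comp.
rewrite -(ge0_integral_normal_prob mnh) => [|x]; last exact: normr_ge0.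
move=> H; exact: H.
Qed.

(** The nonnegative case applies to [h + g] and to [g], where [g x = C * (1 + x ^+ 2)] dominates the
    absolute value of [h]; the contribution of [g] then cancels. *)
Lemma Rintegral_normal_prob (h : R -> R) (C : R) :
  measurable_fun setT h -> (forall x, `|h x| <= C * (1 + x ^+ 2))%R ->
  (\int[gam]_x h x = \int[mu]_x (h x * phi x))%R.
Proof.
move=> mh hC.
have ih := integrable_normal_prob mh hC.
have ihp := quadratic_growth_integrable mh hC.
have C0 : (0 <= C)%R.
  by have := hC 0%R; rewrite expr0n addr0 mulr1; exact: le_trans.
pose g x := (C * (1 + x ^+ 2))%R.
have g0 x : (0 <= g x)%R by rewrite mulr_ge0// addr_ge0// sqr_ge0.
have mg : measurable_fun setT g.
  by apply: measurable_funM => //; apply: measurable_funD => //;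
      exact: exprn_measurable.
have gC x : (`|g x| <= C * (1 + x ^+ 2))%R by rewrite ger0_norm.
have ig := integrable_normal_prob mg gC.
have igp := quadratic_growth_integrable mg gC.
have h1 : (\int[gam]_x (h x + g x) = \int[mu]_x ((h x + g x) * phi x))%R.
  rewrite /Rintegral ge0_integral_normal_prob//.
    exact: measurable_funD.
  by move=> x; have := hC x; rewrite ler_norml => /andP[+ _]; rewrite -/(g x); lra.
have h2 : (\int[gam]_x (g x) = \int[mu]_x (g x * phi x))%R.
  by rewrite /Rintegral ge0_integral_normal_prob.
move: h1; rewrite RintegralD// h2.
under [RHS]eq_Rintegral do rewrite mulrDl.
by rewrite RintegralD// => /addIr.
Qed.

End normal_prob_integral.

(** * Stein's identity for the standard Gaussian law *)

Section stein.
Context {R : realType}.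
Notation mu := (@lebesgue_measure R).
Notation gam := (normal_prob (0 : R) (1 : R)).
Notation phi := (normal_pdf (0 : R) (1 : R)).

Lemma is_derive_normal_pdf (x : R) : is_derive x (1 : R) phi (- x * phi x)%R.
Proof.
rewrite (_ : phi = (fun x => normal_peak 1 * expR (- x ^+ 2 / 2))%R); last first.
  by apply/funext => y; exact: normal_pdf01E.
pose g (y : R) : R := (- y ^+ 2 / 2)%R.
have dg : is_derive x (1 : R) g (- x)%R.
  rewrite (_ : g = (- 2^-1) \*: (fun y : R => y ^+ 2))%R; last first.
    by apply/funext => y; rewrite /g /= /GRing.scale/=; field.
  apply: is_derive_eq; rewrite /GRing.scale/=.
  by field.
have de : is_derive x (1 : R) (expR \o g) (- x * expR (g x))%R.
  by rewrite mulrC; apply: is_derive1_comp.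
have dp : is_derive x (1 : R) (normal_peak 1 \*: (expR \o g))%R
     (normal_peak 1 *: (- x * expR (g x)))%R by exact: is_deriveZ.
apply: is_derive_eq.
by rewrite /GRing.scale/= /g; ring.
Qed.

(** Pointwise decay, which kills the boundary terms in Stein's identity. The 16 is the square of 4:
    [1 + y <= 4 * (1 + y / 4) <= 4 * expR (y / 4)] with [y = x ^+ 2], and squaring leaves
    [expR (y / 2)]. *)
Lemma quadratic_growth_normal_pdf (h : R -> R) (C x : R) :
  (`|h x| <= C * (1 + x ^+ 2))%R ->
  (`|h x * phi x| <= C * normal_peak 1 * 16 / (1 + x ^+ 2))%R.
Proof.
move=> hC.
have C0 : (0 <= C)%R.
  by rewrite -(@pmulr_lge0 _ (1 + x ^+ 2))%R ?(le_trans _ hC)// ltr_pwDl ?sqr_ge0.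
rewrite normrM (ger0_norm (normal_pdf_ge0 _ _ _)) normal_pdf01E.
apply: (@le_trans _ _ (C * (1 + x ^+ 2) *
    (normal_peak 1 * expR (- x ^+ 2 / 2))))%R.
  by rewrite ler_wpM2r// mulr_ge0 ?normal_peak_ge0 ?expR_ge0.
rewrite [leLHS](_ : _ = C * normal_peak 1 *
    ((1 + x ^+ 2) * expR (- x ^+ 2 / 2)))%R; last by ring.
rewrite [leRHS](_ : _ = C * normal_peak 1 * (16 / (1 + x ^+ 2)))%R;
    last by rewrite mulrA.
rewrite ler_wpM2l// ?mulr_ge0 ?normal_peak_ge0//.
have x0 := sqr_ge0 x.
rewrite mulNr expRN ler_pdivlMr; last by lra.
rewrite mulrAC ler_pdivrMr ?expR_gt0//.
have -> : (x ^+ 2 / 2 = x ^+ 2 / 4 + x ^+ 2 / 4)%R by field.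
rewrite expRD; have := expR_ge1Dx (x ^+ 2 / 4)%R.
move: x0; move: (expR _) => e; move: (x ^+ 2)%R => y y0 ye.
have : ((1 + y / 4) * (1 + y / 4) <= e * e)%R by apply: ler_pM => //; lra.
nra.
Qed.

(** The integrand times [phi] is the derivative of [h * phi], because [phi' = - x phi]. The
    fundamental theorem of calculus on symmetric intervals leaves boundary terms that tend to 0, and
    dominated convergence passes to the whole line. *)
Lemma stein (h dh : R -> R) (C : R) :
  (forall x, is_derive x (1 : R) h (dh x)) -> continuous dh ->
  (forall x, `|h x| <= C * (1 + x ^+ 2))%R ->
  (forall x, `|dh x - x * h x| <= C * (1 + x ^+ 2))%R ->
  (\int[gam]_x (dh x - x * h x) = 0)%R.
Proof.
move=> dhh cdh hC kC.
have ch : continuous h.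
  by move=> x; apply: differentiable_continuous; apply/derivable1_diffP;
      have [] := dhh x.
have ck : continuous (fun x => dh x - x * h x)%R.
  by move=> x; apply: cvgB; [exact: cdh|apply: cvgM; [exact: cvg_id|exact: ch]].
have mk := continuous_measurable_fun ck.
rewrite (Rintegral_normal_prob mk kC).
pose k x := ((dh x - x * h x) * phi x)%R.
have ckk : continuous k.
  move=> x; apply: cvgM; first exact: ck.
  by apply: continuous_normal_pdf; rewrite oner_eq0.
have mkk : measurable_fun setT k by exact: continuous_measurable_fun.
have ik : mu.-integrable setT (EFin \o k) := quadratic_growth_integrable mk kC.
pose F x := (h x * phi x)%R.
have dF (x : R) : is_derive x (1 : R) F (k x).
  have dphi := is_derive_normal_pdf x.
  have dh' := dhh x.
  have : is_derive x (1 : R) (h * phi)%R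
     (h x *: (- x * phi x) + phi x *: dh x)%R by exact: is_deriveM.
  move=> H; apply: (@is_derive_eq _ _ _ _ _ _ _ _ H).
  by rewrite /k /GRing.scale/=; ring.
have dF1 (x : R) : derivable F x 1 by have [] := dF x.
have cF : continuous F.
  by move=> x; apply: differentiable_continuous; exact/derivable1_diffP.
pose I n := `[- n.+1%:R : R, n.+1%:R]%classic.
have intI n : (\int[mu]_(x in I n) (k x)%:E = (F n.+1%:R - F (- n.+1%:R))%:E)%E.
  rewrite EFinB; apply: continuous_FTC2.
  - by rewrite (@lt_trans _ _ 0%R)// ?oppr_lt0 ltr0n.
  - exact/continuous_subspaceT.
  - split => [x _| |]; first exact: dF1.
    + exact/cvg_at_right_filter/cF.
    + exact/cvg_at_left_filter/cF.
  - by move=> x _; rewrite derive1E; have [_ ->] := dF x.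
have lim0 : (F n.+1%:R - F (- n.+1%:R) : R)%R @[n --> \oo] --> (0 : R)%R.
  pose K := (C * normal_peak 1 * 16 : R)%R.
  have C0 : (0 <= C)%R.
    by have := hC 0%R; rewrite expr0n addr0 mulr1; exact: le_trans.
  have K0 : (0 <= K)%R by rewrite !mulr_ge0 ?normal_peak_ge0.
  have bd (x : R) n : (x ^+ 2 = n.+1%:R ^+ 2)%R -> (`|F x| <= K * harmonic n)%R.
    move=> xn; apply: (le_trans (quadratic_growth_normal_pdf (hC x))).
    rewrite -/K ler_wpM2l// /harmonic/= lef_pV2 ?posrE ?ltr_pwDl ?sqr_ge0 ?ltr0n//.
    by rewrite xn ler_wpDl// -natrX ler_nat (@leq_pmulr n.+1 n.+1).
  have z : (K * harmonic n + K * harmonic n : R)%R @[n --> \oo] --> (0 : R)%R.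
    rewrite -[X in _ --> X](_ : K * 0 + K * 0 = 0)%R; last by rewrite !mulr0 addr0.
    by apply: cvgD; apply: cvgMl_tmp; exact: cvg_harmonic.
  apply/norm_cvg0P; apply: (squeeze_cvgr _ (cvg_cst 0%R) z).
  apply: nearW => n; rewrite normr_ge0/= (le_trans (ler_normB _ _))// lerD// bd//.
  by rewrite sqrrN.
have dc : (\int[mu]_x ((k \_ (I n)) x)%:E @[n --> \oo] --> \int[mu]_x (k x)%:E)%E.
  apply: (@dominated_cvg _ _ _ mu setT measurableT _ _ (fun x => `|k x|%:E)).
  - move=> n; apply/measurable_EFinP; apply/(measurable_restrictT _ _).1;
      first exact: measurable_itv.
    exact: measurable_funTS.
  - move=> x _; apply: cvg_EFin; first exact: nearW.
    apply: (cvg_near_cst).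
    near=> n; rewrite /= patchE ifT// inE /I/= in_itv/= -ler_norml.
    rewrite (@le_trans _ _ n%:R)//; last by rewrite ler_nat.
    by near: n; exact: nbhs_infty_ger.
  - by [].
  - exact: (integrable_abse ik).
  - by move=> n x _; rewrite lee_fin patchE; case: ifPn => //; rewrite normr0.
have : (fun n => (F n.+1%:R - F (- n.+1%:R)%R)%:E) @ \oo --> (\int[mu]_x (k x)%:E)%E.
  apply: cvg_trans dc; apply: near_eq_cvg; apply: nearW => n.
  rewrite -intI [RHS]integral_mkcond; apply: eq_integral => x _.
  by rewrite restrict_EFin.
move=> H; rewrite /Rintegral.
rewrite (@cvg_unique _ _ _ _ _ _ H (cvg_EFin _ lim0))//.
exact: nearW.
Unshelve. all: by end_near. Qed.

End stein.

(** * Moments and characteristic function, by Stein's identity *)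

Section normal_moments.
Context {R : realType}.
Notation gam := (normal_prob (0 : R) (1 : R)).

Let id_growth (x : R) : `|x| <= 2 * (1 + x ^+ 2).
Proof. by rewrite ler_norml; have := sqr_ge0 (x - 1); have := sqr_ge0 (x + 1); nra. Qed.

Let bounded_growth (h : R -> R) : (forall x, `|h x| <= 1) ->
  forall x, `|h x| <= 2 * (1 + x ^+ 2).
Proof. by move=> h1 x; apply: (le_trans (h1 x)); have := sqr_ge0 x; lra. Qed.

Lemma integrable_normal_id : gam.-integrable setT (EFin \o (fun x : R => x)).
Proof. exact: (integrable_normal_prob _ id_growth). Qed.

Lemma integrable_normal_sqr : gam.-integrable setT (EFin \o (fun x : R => x ^+ 2)).
Proof.
apply: (@integrable_normal_prob _ _ 1); first exact: exprn_measurable.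
by move=> x; rewrite ger0_norm ?sqr_ge0// mul1r lerDr.
Qed.

Lemma normal_mean : (\int[gam]_x x)%R = 0.
Proof.
have : \int[gam]_x ((cst (0 : R)) x - x * (cst (1 : R)) x) = 0.
  apply: (@stein R (cst 1) (cst 0) 2).
  - by move=> x; exact: cvg_cst.
  - by move=> x; rewrite normr1; have := sqr_ge0 x; lra.
  - by move=> x; rewrite sub0r normrN mulr1.
under eq_Rintegral do rewrite sub0r mulr1 -mulN1r.
by rewrite RintegralZl//; [lra|exact: integrable_normal_id].
Qed.

Lemma normal_second_moment : \int[gam]_x (x ^+ 2) = 1.
Proof.
have : \int[gam]_x ((cst (1 : R)) x - x * x) = 0.
  apply: (@stein R id (cst 1) 2).
  - by move=> x; exact: cvg_cst.
  - exact: id_growth.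
  - by move=> x /=; rewrite ler_norml; have := sqr_ge0 x; rewrite expr2; lra.
rewrite RintegralB//; last 2 first.
- exact: finite_measure_integrable_cst.
- exact: integrable_normal_sqr.
rewrite Rintegral_cst//= [X in fine X]probability_setT mul1r => /eqP.
by rewrite subr_eq0 => /eqP/esym.
Qed.

Lemma cos_affine_measurable (c s : R) :
  measurable_fun setT (fun x : R => cos (c + s * x)).
Proof.
apply: measurableT_comp; first by apply: continuous_measurable_fun;
    exact: continuous_cos.
by apply: measurable_funD => //; apply: measurable_funM.
Qed.

Let is_derive_affine (c s x : R) : is_derive x (1 : R) (fun x : R => c + s * x) s.
Proof.
by apply: is_derive_eq; rewrite /GRing.scale/=; ring.
Qed.

Let is_derive_cos_affine (c s x : R) :
  is_derive x (1 : R) (fun x : R => cos (c + s * x)) (- (s * sin (c + s * x))).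
Proof.
have := @is_derive1_comp R cos (fun x : R =>
    c + s * x) x _ _ (is_derive_cos _) (is_derive_affine c s x).
by rewrite mulNr mulrC.
Qed.

Let is_derive_sin_affine (c s x : R) :
  is_derive x (1 : R) (fun x : R => sin (c + s * x)) (s * cos (c + s * x)).
Proof.
have := @is_derive1_comp R sin (fun x : R =>
    c + s * x) x _ _ (is_derive_sin _) (is_derive_affine c s x).
by rewrite mulrC.
Qed.

Let continuous_affine (c s : R) : continuous (fun x : R => c + s * x).
Proof. by move=> x; apply: cvgD; [exact: cvg_cst|apply: cvgMl_tmp; exact: cvg_id]. Qed.

Let integrable_cos_affine (c s : R) :
  gam.-integrable setT (EFin \o (fun x : R => cos (c + s * x))).
Proof.
apply: (integrable_normal_prob (cos_affine_measurable c s)).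
by apply: bounded_growth => x; exact: cos_max.
Qed.

Let integrable_id_sin (c s : R) :
  gam.-integrable setT (EFin \o (fun x : R => x * sin (c + s * x))).
Proof.
apply: (@integrable_normal_prob _ _ 2).
  apply: measurable_funM => //; apply: measurableT_comp.
    apply: continuous_measurable_fun; exact: continuous_sin.
  by apply: measurable_funD => //; apply: measurable_funM.
move=> x; rewrite normrM (le_trans _ (id_growth x))//.
by rewrite ler_piMr ?sin_max.
Qed.

(** Stein's identity for [sin (c + s * x)]: the left-hand side is, up to sign, the derivative in [s]
    of the integral on the right, which closes a differential equation. *)
Let stein_sin (c s : R) :
  \int[gam]_x (x * sin (c + s * x)) = s * \int[gam]_x cos (c + s * x).
Proof.
have : \int[gam]_x (s * cos (c + s * x) - x * sin (c + s * x)) = 0.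
  apply: (@stein R (fun x => sin (c + s * x)) _ (`|s| + 2)).
  - by move=> x; exact: is_derive_sin_affine.
  - move=> x; apply: cvgMl_tmp; apply: continuous_comp; first exact: continuous_affine.
    exact: continuous_cos.
  - move=> x; apply: (le_trans (sin_max _)); have := sqr_ge0 x.
    by have := normr_ge0 s; nra.
  - move=> x; apply: (le_trans (ler_normB _ _)); rewrite !normrM.
    rewrite mulrDl lerD//.
      rewrite ler_wpM2l//; apply: (le_trans (cos_max _)); have := sqr_ge0 x; lra.
    by apply: (le_trans _ (id_growth x)); rewrite ler_piMr ?sin_max.
have isc : gam.-integrable setT (EFin \o (fun x : R => s * cos (c + s * x))).
  apply: (@integrable_normal_prob _ _ `|s|).
    by apply: measurable_funM => //; exact: cos_affine_measurable.
  by move=> x; rewrite normrM ler_wpM2l// (le_trans (cos_max _))// lerDl sqr_ge0.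
rewrite (RintegralB measurableT isc (integrable_id_sin c s)).
rewrite RintegralZl//.
by move/eqP; rewrite subr_eq0 => /eqP/esym.
Qed.

(** Differentiation under the integral sign, with [|x|] as integrable bound of the derivative in
    [s]; [stein_sin] rewrites the result. *)
Let is_derive_charac (c a : R) :
  is_derive a (1 : R) (fun s => \int[gam]_x cos (c + s * x))
    (- (a * \int[gam]_x cos (c + a * x))).
Proof.
pose f (s x : R) := cos (c + s * x).
have df (s x : R) : is_derive s (1 : R) (f ^~ x) (- (x * sin (c + s * x))).
  by have := is_derive_cos_affine c x s; rewrite (mulrC x s) /f;
     under [X in is_derive _ _ X _]eq_fun do rewrite mulrC.
have d1f s x : partial1of2 f s x = - (x * sin (c + s * x)).
  by rewrite partial1of2E; have [_ ->] := df s x.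
have Ia : `]a - 1, a + 1[%classic a by rewrite /= in_itv/=; apply/andP; split; lra.
have intf s : `]a - 1, a + 1[%classic s -> gam.-integrable setT (EFin \o f s).
  by move=> _; exact: integrable_cos_affine.
have derf s x : `]a - 1, a + 1[%classic s -> [set: R] x -> derivable (f ^~ x) s 1.
  by move=> _ _; have [] := df s x.
have iG : gam.-integrable setT (EFin \o (fun x : R => `|x|)).
  exact: (integrable_abse integrable_normal_id).
have G_ub s x : `]a - 1, a + 1[%classic s -> [set: R] x ->
    `|partial1of2 f s x| <= `|x|.
  by move=> _ _; rewrite d1f normrN normrM ler_piMr ?sin_max.
have dF := derivable_under_integral measurableT Ia intf derf (@normr_ge0 _ R) iG G_ub.
have F' := differentiation_under_integral measurableT Ia intf derf
    (@normr_ge0 _ R) iG G_ub.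
apply: DeriveDef; first exact: dF.
rewrite -derive1E F'.
under eq_Rintegral do rewrite d1f -mulN1r.
by rewrite RintegralZl// stein_sin mulN1r.
Qed.

(** With [F' = - s F] and [E' = s E], the product [F * E] has zero derivative, so it keeps its value
    [cos c] at 0. *)
Lemma normal_charac (c s : R) :
  \int[gam]_x cos (c + s * x) = cos c * expR (- (s ^+ 2 / 2)).
Proof.
pose F (s : R) := \int[gam]_x cos (c + s * x).
pose E (s : R) := expR (s ^+ 2 / 2).
have dE (t : R) : is_derive t (1 : R) E (t * E t).
  have dg : is_derive t (1 : R) (fun y : R => y ^+ 2 / 2) t.
    rewrite (_ : (fun y : R => y ^+ 2 / 2) = 2^-1 \*: (fun y : R => y ^+ 2));
        last first.
      by apply/funext => y; rewrite /GRing.scale/= mulrC.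
    by apply: is_derive_eq; rewrite /GRing.scale/=; field.
  by rewrite mulrC; apply: is_derive1_comp.
have dFE (t : R) : is_derive t (1 : R) (F * E) 0.
  have dF := is_derive_charac c t; have dEt := dE t.
  have : is_derive t (1 : R) (F * E) (F t *: (t * E t) + E t *: (- (t * F t))).
    exact: is_deriveM.
  move=> H; apply: (@is_derive_eq _ _ _ _ _ _ _ _ H).
  by rewrite /GRing.scale/=; ring.
have : F s * E s = F 0 * E 0 := is_derive_0_is_cst s 0 dFE.
rewrite {2}/E expr0n/= mul0r expR0 mulr1 {2}/F.
under eq_Rintegral do rewrite mul0r addr0.
rewrite Rintegral_cst//= [X in fine X]probability_setT mulr1 => <-.
by rewrite expRN mulfK// gt_eqF// expR_gt0.
Qed.

End normal_moments.

(** * Square-integrable functions *)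

Section square_integrable.
Local Open Scope ereal_scope.
Context d (T : measurableType d) (R : realType) (mu : {measure set T -> \bar R}).

Lemma Lfun2P (f : T -> R) : measurable_fun setT f ->
  \int[mu]_x (f x ^+ 2)%:E < +oo -> f \in Lfun mu 2%:E.
Proof.
move=> mf foo; rewrite inE; apply/andP; split; rewrite inE//=.
rewrite /finite_norm unlock /= poweR_lty//.
rewrite (eq_integral (fun x => (f x ^+ 2)%:E))// => x _ /=.
by rewrite powR_mulrn// real_normK// num_real.
Qed.

Lemma Lfun2_measurable (f : T -> R) : f \in Lfun mu 2%:E -> measurable_fun setT f.
Proof. by rewrite inE => /andP[/[!inE]]. Qed.

End square_integrable.

Section finite_measure.
Context d (T : measurableType d) (R : realType).
Variable mu : {finite_measure set T -> \bar R}.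

Lemma bounded_Lfun2 (f : T -> R) (M : R) :
  measurable_fun setT f -> (forall x, `|f x| <= M) -> f \in Lfun mu 2%:E.
Proof.
move=> mf fM; apply: Lfun2P => //.
apply: (@le_lt_trans _ _ (\int[mu]_x (M ^+ 2)%:E))%E.
  apply: ge0_le_integral => //.
  - by move=> x _; rewrite lee_fin sqr_ge0.
  - by apply/measurable_EFinP; apply: measurable_funX.
  - move=> x _; rewrite lee_fin -(@real_normK _ (f x)) ?num_real//.
    by rewrite ler_pXn2r// nnegrE (le_trans _ (fM x)).
rewrite integral_cst// lte_mul_pinfty ?lee_fin ?sqr_ge0//.
by rewrite ltey_eq fin_num_measure.
Qed.

Lemma bounded_integrable (f : T -> R) (M : R) :
  measurable_fun setT f -> (forall x, `|f x| <= M) ->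
  mu.-integrable setT (EFin \o f).
Proof.
move=> mf fM; apply/Lfun1_integrable; apply: Lfun_subset12.
  exact: fin_num_measure.
exact: bounded_Lfun2 fM.
Qed.

Lemma Lfun2_integrable (f : T -> R) :
  f \in Lfun mu 2%:E -> mu.-integrable setT (EFin \o f).
Proof.
move=> f2; apply/Lfun1_integrable; apply: Lfun_subset12 => //.
exact: fin_num_measure.
Qed.

Lemma Lfun2_mul_integrable (f g : T -> R) :
  f \in Lfun mu 2%:E -> g \in Lfun mu 2%:E ->
  mu.-integrable setT (EFin \o (fun x => f x * g x)).
Proof. by move=> f2 g2; apply/Lfun1_integrable; exact: Lfun2_mul_Lfun1. Qed.

End finite_measure.

(** * Bivariate Gaussian pairs *)

Section gaussian_plane.
Context {R : realType}.
Notation gam := (normal_prob (0 : R) (1 : R)).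
Notation gam2 := (gam \x gam)%E.

Definition affine (m a b : R) (z : R * R) : R := m + a * z.1 + b * z.2.

Lemma affine_measurable (m a b : R) : measurable_fun setT (affine m a b).
Proof.
apply: measurable_funD; last by apply: measurable_funM.
by apply: measurable_funD => //; apply: measurable_funM.
Qed.

Let affine_moment1 (a b c e : R) :
  gam.-integrable setT (EFin \o (fun x => (a + b * x) * (c + e * x))) /\
  \int[gam]_x ((a + b * x) * (c + e * x)) = a * c + b * e.
Proof.
have i1 : gam.-integrable setT (EFin \o (fun=> a * c)).
  exact: finite_measure_integrable_cst.
have i2 : gam.-integrable setT (EFin \o (fun x => (a * e + b * c) * x)).
  apply: (@integrable_normal_prob _ _ (`|a * e + b * c| * 2)).
    exact: measurable_funM.
  move=> x; rewrite normrM -mulrA ler_wpM2l// ler_norml.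
  by have := sqr_ge0 (x - 1); have := sqr_ge0 (x + 1); nra.
have i3 : gam.-integrable setT (EFin \o (fun x => (b * e) * x ^+ 2)).
  apply: (@integrable_normal_prob _ _ `|b * e|).
    by apply: measurable_funM => //; exact: exprn_measurable.
  by move=> x; rewrite normrM ler_wpM2l// ger0_norm ?sqr_ge0// lerDr.
have i12 := integrableD measurableT i1 i2.
have i123 := integrableD measurableT i12 i3.
have e0 x : (a + b * x) * (c + e * x) =
    a * c + (a * e + b * c) * x + (b * e) * x ^+ 2 by ring.
split.
  by apply: eq_integrable i123 => // x _; rewrite /= e0 !EFinD.
under eq_Rintegral do rewrite e0.
rewrite RintegralD// RintegralD//.
rewrite Rintegral_cst//= [X in fine X]probability_setT mulr1.
rewrite RintegralZl//; last exact: integrable_normal_id.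
rewrite RintegralZl//; last exact: integrable_normal_sqr.
by rewrite normal_mean normal_second_moment mulr0 mulr1 addr0.
Qed.

(** Computed by Tonelli, which asks for no integrability. It supplies the square-integrability that
    Fubini needs for products of distinct affine functions. *)
Let affine_sqr (m a b : R) :
  (\int[gam2]_z (affine m a b z ^+ 2)%:E = (m ^+ 2 + a ^+ 2 + b ^+ 2)%:E)%E.
Proof.
have mf : measurable_fun setT (fun z => (affine m a b z ^+ 2)%:E).
  by apply/measurable_EFinP; apply: measurable_funX; exact: affine_measurable.
have f0 z : (0 <= (affine m a b z ^+ 2)%:E)%E by rewrite lee_fin sqr_ge0.
rewrite (@fubini_tonelli1 _ _ _ _ _ gam gam _ mf f0).
have H x : fubini_F gam (fun z => (affine m a b z ^+ 2)%:E) x =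
    ((m + a * x) * (m + a * x) + b * b)%:E.
  rewrite /fubini_F; have [ii <-] := affine_moment1 (m + a * x) b (m + a * x) b.
  by rewrite fineK; [apply: eq_integral|exact: integrable_fin_num].
transitivity (\int[gam]_x ((m + a * x) * (m + a * x) + b * b)%:E)%E;
    first by apply: eq_integral => x _; exact: H.
have [ii e] := affine_moment1 m a m a.
under eq_integral do rewrite EFinD.
rewrite integralD//; last exact: finite_measure_integrable_cst.
rewrite integral_cst// [X in (_ * X)%E]probability_setT mule1.
rewrite -[X in (X + _)%E]fineK; last exact: integrable_fin_num.
by rewrite [fine _]e -EFinD !expr2.
Qed.

Lemma normal_plane_lty : (gam2 setT < +oo)%E.
Proof.
have := @product_measure1E _ _ _ _ _ gam gam setT setT measurableT measurableT.
by rewrite setXTT => ->; rewrite [X in (X * _)%E]probability_setT [X in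
    (_ * X)%E]probability_setT mule1 ltry.
Qed.

Lemma affine_Lfun2 (m a b : R) : affine m a b \in Lfun gam2 2%:E.
Proof.
apply: Lfun2P; first exact: affine_measurable.
by rewrite affine_sqr ltry.
Qed.

Lemma affine_moment (m a b m' a' b' : R) :
  (\int[gam2]_z (affine m a b z * affine m' a' b' z)%:E =
  (m * m' + a * a' + b * b')%:E)%E.
Proof.
have ii : gam2.-integrable setT (EFin \o (affine m a b \* affine m' a' b')).
  by apply/Lfun1_integrable; apply: Lfun2_mul_Lfun1; exact: affine_Lfun2.
rewrite -(@integral12_prod_meas1 _ _ _ _ _ gam gam _ ii).
have H x : fubini_F gam (EFin \o (affine m a b \* affine m' a' b')) x =
    ((m + a * x) * (m' + a' * x) + b * b')%:E.
  rewrite /fubini_F; have [i2 <-] := affine_moment1 (m + a * x) b (m' + a' * x) b'.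
  by rewrite fineK; [apply: eq_integral|exact: integrable_fin_num].
transitivity (\int[gam]_x ((m + a * x) * (m' + a' * x) + b * b')%:E)%E;
    first by apply: eq_integral => x _; exact: H.
have [i1 e] := affine_moment1 m a m' a'.
under eq_integral do rewrite EFinD.
rewrite integralD//; last exact: finite_measure_integrable_cst.
rewrite integral_cst// [X in (_ * X)%E]probability_setT mule1.
rewrite -[X in (X + _)%E]fineK; last exact: integrable_fin_num.
by rewrite [fine _]e -EFinD.
Qed.

(** Fubini and two uses of [normal_charac]: the inner integral has frequency [b] and phase
    [m + a * x], the outer one frequency [a] and phase [m]. *)
Lemma affine_charac (m a b : R) :
  (\int[gam2]_z (cos (affine m a b z))%:E =
  (cos m * expR (- ((a ^+ 2 + b ^+ 2) / 2)))%:E)%E.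
Proof.
have mcos : measurable_fun setT (fun z => cos (affine m a b z)).
  apply: measurableT_comp; last exact: affine_measurable.
  by apply: continuous_measurable_fun; exact: continuous_cos.
have ii : gam2.-integrable setT (EFin \o (fun z => cos (affine m a b z))).
  apply: measurable_bounded_integrable => //; first exact: normal_plane_lty.
  by exists 1; split => // x x1 z _; exact: (le_trans (cos_max _) (ltW x1)).
rewrite -(@integral12_prod_meas1 _ _ _ _ _ gam gam _ ii).
have icos c s : gam.-integrable setT (EFin \o (fun x : R => cos (c + s * x))).
  apply: (@bounded_integrable _ _ _ gam _ 1); first exact: cos_affine_measurable.
  by move=> x; exact: cos_max.
have H x : fubini_F gam (EFin \o (fun z => cos (affine m a b z))) x =
    (cos (m + a * x) * expR (- (b ^+ 2 / 2)))%:E.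
  rewrite /fubini_F -normal_charac fineK;
      last exact: (integrable_fin_num measurableT (icos _ _)).
  exact: eq_integral.
transitivity (\int[gam]_x (cos (m + a * x) * expR (- (b ^+ 2 / 2)))%:E)%E;
    first by apply: eq_integral => x _; exact: H.
have -> : (\int[gam]_x (cos (m + a * x) * expR (- (b ^+ 2 / 2)))%:E =
    (expR (- (b ^+ 2 / 2)))%:E * \int[gam]_x (cos (m + a * x))%:E)%E.
  rewrite -(integralZl measurableT (icos m a)).
  by apply: eq_integral => x _; rewrite mulrC EFinM.
rewrite -[X in (_ * X)%E]fineK; last exact: (integrable_fin_num measurableT (icos _ _)).
rewrite [fine _]normal_charac -EFinM mulrCA -expRD; congr (_ * expR _)%:E.
by field.
Qed.

End gaussian_plane.

Section bivariate.
Context d (Omega : measurableType d) (R : realType) (P : probability Omega R).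
Notation gam := (normal_prob (0 : R) (1 : R)).
Notation gam2 := (gam \x gam)%E.

(** The matrix that represents the pair is not unique, but the means and covariances determine the
    characteristic function. The first two moments are therefore computed from the matrix, which is
    then eliminated. *)
Lemma bivariate_gaussian_charac (X Y : Omega -> R) :
  measurable_fun setT X -> measurable_fun setT Y -> bivariate_gaussian P X Y ->
  [/\ X \in Lfun P 2%:E, Y \in Lfun P 2%:E &
    forall c s t : R, (\int[P]_w cos (c + s * X w + t * Y w) =
      cos (c + s * fine 'E_P[X] + t * fine 'E_P[Y]) *
      expR (- ((s ^+ 2 * fine 'V_P[X] + 2 * s * t * fine (covariance P X Y) +
                t ^+ 2 * fine 'V_P[Y]) / 2)))%R].
Proof.
move=> mX mY [m1 [m2 [a11 [a12 [a21 [a22 H]]]]]].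
pose W w := (X w, Y w).
pose L (z : measurableTypeR R * measurableTypeR R) : R * R :=
    (affine m1 a11 a12 z, affine m2 a21 a22 z).
have mW : measurable_fun setT W by exact: measurable_fun_pair.
have mL : measurable_fun setT L.
  by apply: measurable_fun_pair; exact: affine_measurable.
(* Transfer of nonnegative integrands comes first: it needs no integrability and yields that [X] and
   [Y] are square-integrable, which licenses the transfer of signed integrands. *)
have ge0_transfer (h : R * R -> \bar R) : measurable_fun setT h ->
    (forall z, 0 <= h z)%E ->
    (\int[P]_w h (W w) = \int[gam2]_z h (L z))%E.
  move=> mh h0.
  transitivity (\int[pushforward P W]_y h y)%E.
    by rewrite (ge0_integral_pushforward mW)// => y _.
  transitivity (\int[pushforward gam2 L]_y h y)%E; last first.
    by rewrite (ge0_integral_pushforward mL)// => y _.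
  by apply: eq_measure_integral => A mA _; exact: H.
have transfer (h : R * R -> \bar R) : measurable_fun setT h ->
    P.-integrable setT (h \o W) -> gam2.-integrable setT (h \o L) ->
    (\int[P]_w h (W w) = \int[gam2]_z h (L z))%E.
  move=> mh i1 i2.
  transitivity (\int[pushforward P W]_y h y)%E.
    by rewrite (integral_pushforward mW).
  transitivity (\int[pushforward gam2 L]_y h y)%E; last first.
    by rewrite (integral_pushforward mL).
  by apply: eq_measure_integral => A mA _; exact: H.
have mf1 : measurable_fun setT (@fst R R) by exact: measurable_fst.
have mf2 : measurable_fun setT (@snd R R) by exact: measurable_snd.
have X2 : X \in Lfun P 2%:E.
  apply: Lfun2P => //.
  rewrite (ge0_transfer (fun z => (z.1 ^+ 2)%:E)); last 2 first.
  - by apply/measurable_EFinP; exact: measurable_funX.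
  - by move=> z; rewrite lee_fin sqr_ge0.
  under eq_integral do rewrite expr2.
  by rewrite affine_moment ltry.
have Y2 : Y \in Lfun P 2%:E.
  apply: Lfun2P => //.
  rewrite (ge0_transfer (fun z => (z.2 ^+ 2)%:E)); last 2 first.
  - by apply/measurable_EFinP; exact: measurable_funX.
  - by move=> z; rewrite lee_fin sqr_ge0.
  under eq_integral do rewrite expr2.
  by rewrite affine_moment ltry.
have aff1 (m a b : R) : gam2.-integrable setT (EFin \o affine m a b).
  have c1 : affine 1 0 0 = cst (1 : R).
    by apply/funext => z; rewrite /affine !mul0r !addr0.
  have := Lfun2_mul_Lfun1 (affine_Lfun2 m a b) (affine_Lfun2 1 0 0).
  move=> /Lfun1_integrable; apply: eq_integrable => // z _.
  by rewrite c1 /= mulr1.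
have aff_mean (m a b : R) : (\int[gam2]_z (affine m a b z)%:E = m%:E)%E.
  have c1 : affine 1 0 0 = cst (1 : R).
    by apply/funext => z; rewrite /affine !mul0r !addr0.
  have := affine_moment m a b 1 0 0; rewrite c1 !mulr0 !addr0 mulr1 => <-.
  by apply: eq_integral => z _; rewrite /= mulr1.
have EX : ('E_P[X] = m1%:E)%E.
  rewrite unlock (transfer (fun z => z.1%:E)) ?aff_mean//.
  - exact/measurable_EFinP.
  - exact: Lfun2_integrable.
  - exact: aff1.
have EY : ('E_P[Y] = m2%:E)%E.
  rewrite unlock (transfer (fun z => z.2%:E)) ?aff_mean//.
  - exact/measurable_EFinP.
  - exact: Lfun2_integrable.
  - exact: aff1.
have X1 : X \in Lfun P 1 by apply: Lfun_subset12 X2; exact: fin_num_measure.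
have Y1 : Y \in Lfun P 1 by apply: Lfun_subset12 Y2; exact: fin_num_measure.
have EXX : ('E_P[X * X] = (m1 * m1 + a11 * a11 + a12 * a12)%:E)%E.
  rewrite unlock (ge0_transfer (fun z => (z.1 * z.1)%:E)) ?affine_moment//.
  - by apply/measurable_EFinP; exact: measurable_funM.
  - by move=> z; rewrite lee_fin -expr2 sqr_ge0.
have EYY : ('E_P[Y * Y] = (m2 * m2 + a21 * a21 + a22 * a22)%:E)%E.
  rewrite unlock (ge0_transfer (fun z => (z.2 * z.2)%:E)) ?affine_moment//.
  - by apply/measurable_EFinP; exact: measurable_funM.
  - by move=> z; rewrite lee_fin -expr2 sqr_ge0.
have EXY : ('E_P[X * Y] = (m1 * m2 + a11 * a21 + a12 * a22)%:E)%E.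
  rewrite unlock (transfer (fun z => (z.1 * z.2)%:E)) ?affine_moment//.
  - by apply/measurable_EFinP; exact: measurable_funM.
  - exact: Lfun2_mul_integrable.
  - by apply/Lfun1_integrable; apply: Lfun2_mul_Lfun1; exact: affine_Lfun2.
have VX : ('V_P[X] = (a11 ^+ 2 + a12 ^+ 2)%:E)%E.
  rewrite /variance covarianceE ?Lfun2_mul_Lfun1// EXX EX -EFinM -EFinB.
  by congr EFin; ring.
have VY : ('V_P[Y] = (a21 ^+ 2 + a22 ^+ 2)%:E)%E.
  rewrite /variance covarianceE ?Lfun2_mul_Lfun1// EYY EY -EFinM -EFinB.
  by congr EFin; ring.
have VXY : (covariance P X Y = (a11 * a21 + a12 * a22)%:E)%E.
  rewrite covarianceE ?Lfun2_mul_Lfun1// EXY EX EY -EFinM -EFinB.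
  by congr EFin; ring.
split => // c s t.
have mcos : measurable_fun setT (fun z : R * R => cos (c + s * z.1 + t * z.2)).
  apply: measurableT_comp.
    by apply: continuous_measurable_fun; exact: continuous_cos.
  apply: measurable_funD; last exact: measurable_funM.
  by apply: measurable_funD => //; exact: measurable_funM.
have LE z : c + s * (L z).1 + t * (L z).2 = affine (c + s * m1 + t * m2)
    (s * a11 + t * a21) (s * a12 + t * a22) z.
  by rewrite /L /affine /=; ring.
rewrite /Rintegral (transfer (fun z => (cos (c + s * z.1 + t * z.2))%:E)); last 3 first.
- exact/measurable_EFinP.
- apply: (@bounded_integrable _ _ _ P _ 1) => [|w]; last exact: cos_max.
  exact: (measurableT_comp mcos mW).
- apply: measurable_bounded_integrable => //.
  + exact: normal_plane_lty.
  + exact: (measurableT_comp mcos mL).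
  + by exists 1; split => // x x1 z _; exact: (le_trans (cos_max _) (ltW x1)).
under eq_integral do rewrite LE.
rewrite affine_charac /= EX EY VX VY VXY /=; congr (_ * expR _).
by field.
Qed.

End bivariate.

(** * Rayleigh quotients *)

Section rayleigh.
Context {R : realType}.

(** The argument is a plain family, not a row vector, so that it can be a family of values of random
    variables at a point of [Omega]. *)
Definition quad_form p (A : 'M[R]_p) (x : 'I_p -> R) : R :=
  \sum_i \sum_j A i j * (x i * x j).

Lemma quad_form_mx p (A : 'M[R]_p) (x : 'rV[R]_p) :
  quad_form A (x 0) = (x *m A *m x^T) 0 0.
Proof.
rewrite /quad_form exchange_big mxE; apply: eq_bigr => j _.
rewrite !mxE mulr_suml; apply: eq_bigr => i _.
by rewrite mulrCA mulrA.
Qed.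

Lemma quad_form_scalar p (a : R) (x : 'I_p -> R) :
  quad_form a%:M x = a * \sum_i x i ^+ 2.
Proof.
rewrite /quad_form mulr_sumr; apply: eq_bigr => i _.
rewrite (bigD1 i)//= big1 ?addr0; first by rewrite mxE eqxx mulr1n expr2.
by move=> j ji; rewrite mxE eq_sym (negbTE ji) mul0r.
Qed.

Lemma quad_formD p (A B : 'M[R]_p) x :
  quad_form (A + B) x = quad_form A x + quad_form B x.
Proof.
rewrite /quad_form -big_split; apply: eq_bigr => i _ /=.
by rewrite -big_split; apply: eq_bigr => j _; rewrite mxE mulrDl.
Qed.

Lemma quad_formN p (A : 'M[R]_p) x : quad_form (- A) x = - quad_form A x.
Proof.
rewrite /quad_form -sumrN; apply: eq_bigr => i _.
by rewrite -sumrN; apply: eq_bigr => j _; rewrite mxE mulNr.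
Qed.

Lemma quad_formB p (A B : 'M[R]_p) x :
  quad_form (A - B) x = quad_form A x - quad_form B x.
Proof. by rewrite quad_formD quad_formN. Qed.

Lemma quad_formZ p (A : 'M[R]_p) (t : R) x :
  quad_form A (fun i => t * x i) = t ^+ 2 * quad_form A x.
Proof.
rewrite /quad_form mulr_sumr; apply: eq_bigr => i _.
by rewrite mulr_sumr; apply: eq_bigr => j _; ring.
Qed.

Let sqnorm p (x : 'rV[R]_p) : R := \sum_i x 0 i ^+ 2.

Let continuous_quad_form p (A : 'M[R]_p) :
  continuous (fun x : 'rV[R]_p => quad_form A (x 0)).
Proof.
have cont_sum (F : 'I_p -> 'rV[R]_p -> R) : (forall i, continuous (F i)) ->
    continuous (fun x => \sum_i F i x).
  move=> cF; apply: (@continuous_big R _ +%R 0 xpredT) => [|i _]; last exact: cF.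
  exact: add_continuous.
apply: (cont_sum) => i; apply: cont_sum => j x.
have cc k : continuous (fun y : 'rV[R]_p => y 0 k).
  by move=> ?; exact: coord_continuous.
exact: (continuousM (@cst_continuous _ _ (A i j) x) (continuousM (cc i x) (cc j x))).
Qed.

Let sqnorm_gt0 p (x : 'rV[R]_p) : x != 0 -> 0 < sqnorm x.
Proof.
move=> x0; rewrite lt_neqAle sumr_ge0 ?andbT => [|i _]; last exact: sqr_ge0.
apply: contra x0 => /eqP/esym/psumr_eq0P H.
apply/eqP/rowP => i; rewrite mxE; apply/eqP; rewrite -sqrf_eq0; apply/eqP.
by apply: H => // j _; exact: sqr_ge0.
Qed.

(** Moving from [u] by [- s] times [w = u *m B] changes the form from 0 to [s ^+ 2 * c - 2 * s * n],
    with [n] the squared length of [w]. For small positive [s] this is negative unless [w = 0]. It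
    serves to turn a minimizer into an eigenvector. *)
Lemma psd_null_vector p (B : 'M[R]_p) (u : 'rV[R]_p) : B^T = B ->
  (forall x : 'rV[R]_p, 0 <= quad_form B (x 0)) -> quad_form B (u 0) = 0 ->
  u *m B = 0.
Proof.
move=> sB psd qu; set w := u *m B.
have [//|w0] := eqVneq w 0.
have n0 := sqnorm_gt0 w0.
have c0 := psd w.
set n := sqnorm w in n0; set c := quad_form B (w 0) in c0.
have expand (s : R) : quad_form B ((u - s *: w) 0) = s ^+ 2 * c - 2 * s * n.
  have nE : n = (w *m w^T) 0 0.
    by rewrite [RHS]mxE; apply: eq_bigr => i _; rewrite [w^T _ _]mxE expr2.
  have -> : c = (w *m B *m w^T) 0 0 by exact: quad_form_mx.
  have uw : u *m B *m w^T = w *m w^T by [].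
  have wu : w *m B *m u^T = w *m w^T.
    by rewrite -mulmxA -{1}sB -trmx_mul.
  move: qu; rewrite !quad_form_mx => qu.
  rewrite mulmxBl linearB/= linearZ/= mulmxBr !mulmxBl -!scalemxAl -!scalemxAr.
  rewrite uw wu nE; move: qu.
  move: (w *m B *m w^T) (w *m w^T) (u *m B *m u^T) => M N K K0.
  by rewrite !mxE K0; ring.
(* The minimizing [s] would be [n / c]; adding 1 to the denominator covers [c = 0] and still gives a
   negative value. *)
have := psd (u - (n / (c + 1)) *: w); rewrite expand.
move: n c n0 c0 {expand} => n c n0 c0.
have -> : (n / (c + 1)) ^+ 2 * c - 2 * (n / (c + 1)) * n =
   - (n ^+ 2 * (c + 2) / (c + 1) ^+ 2) by field; rewrite gt_eqF//; lra.
rewrite oppr_ge0 leNgt; suff -> : 0 < n ^+ 2 * (c + 2) / (c + 1) ^+ 2 by [].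
by rewrite divr_gt0 ?mulr_gt0 ?exprn_gt0//; lra.
Qed.

(** The eigenvalue is the minimum [m] of the form on the unit sphere, attained by compactness. By
    homogeneity [A - m%:M] is positive semidefinite, and its form vanishes at the minimizer, which
    is thus an eigenvector. *)
Lemma rayleigh p (A : 'M[R]_p) : (0 < p)%N -> A^T = A ->
  exists2 a : R, eigenvalue A a &
    forall x, a * \sum_i x i ^+ 2 <= quad_form A x.
Proof.
case: p A => // p A _ sA.
pose S := [set x : 'rV[R]_p.+1 | sqnorm x = 1].
have S0 : S !=set0.
  exists (delta_mx 0 0); rewrite /S /= /sqnorm (bigD1 0)//= big1 ?addr0.
    by rewrite mxE !eqxx expr1n.
  by move=> j j0; rewrite mxE (negbTE j0) andbF expr0n.
have cn : continuous (@sqnorm p.+1).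
  have := @continuous_quad_form p.+1 1%:M.
  by under eq_fun do rewrite quad_form_scalar mul1r.
have clS : closed S.
  rewrite (_ : S = @sqnorm p.+1 @^-1` [set 1])//.
  by apply: closed_comp => [x _|]; [exact: cn|exact: closed_eq].
have bS : bounded_set S.
  exists 1; split => // M M1 x /= xS; rewrite (le_trans _ (ltW M1))//.
  (* The norm on row vectors is the maximum of the absolute values of the entries, while [S] is the
     Euclidean sphere; each squared entry is at most the sum of all. *)
  rewrite [leLHS]/Num.norm /= mx_normrE; apply: bigmax_le => // -[i j] _ /=.
  rewrite ord1 -(@ler_pXn2r _ 2)// ?nnegrE// expr1n real_normK ?num_real//.
  by rewrite -xS /sqnorm (bigD1 j)//= lerDl sumr_ge0// => k _; exact: sqr_ge0.
have [||u uS umin] := @EVT_min_rV R p.+1 (fun x => quad_form A (x 0)) S S0.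
- exact: bounded_closed_compact.
- exact/continuous_subspaceT/continuous_quad_form.
move: uS; rewrite inE /S /= => uS.
set m := quad_form A (u 0) in umin.
have mE : quad_form (A - m%:M) (u 0) = 0.
  by rewrite quad_formB quad_form_scalar -[\sum_i _]/(sqnorm u) uS mulr1 subrr.
have psd (x : 'rV[R]_p.+1) : 0 <= quad_form (A - m%:M) (x 0).
  rewrite quad_formB quad_form_scalar -[\sum_i _]/(sqnorm x) subr_ge0.
  have [->|x0] := eqVneq x 0.
    rewrite /sqnorm big1 ?mulr0; last by move=> i _; rewrite mxE expr0n.
    by rewrite /quad_form big1// => i _; rewrite big1// => j _; rewrite mxE mul0r mulr0.
  have xn := sqnorm_gt0 x0.
  set t := Num.sqrt (sqnorm x); have t0 : 0 < t by rewrite sqrtr_gt0.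
  have tt : t ^+ 2 = sqnorm x by rewrite sqr_sqrtr// ltW.
  have := umin (t^-1 *: x); rewrite inE /S /= => H.
  have : sqnorm (t^-1 *: x) = 1.
    rewrite /sqnorm; under eq_bigr do rewrite mxE exprMn.
    by rewrite -mulr_sumr -/(sqnorm x) -tt -exprMn mulVf ?gt_eqF// expr1n.
  move=> /H; rewrite (_ : quad_form A _ = t^-1 ^+ 2 * quad_form A (x 0)); last first.
    by rewrite -quad_formZ; apply: eq_bigr => i _; apply: eq_bigr => j _; rewrite !mxE.
  by rewrite exprVn mulrC ler_pdivlMr ?exprn_gt0// tt.
exists m.
  apply/eigenvalueP; exists u.
    apply/eqP; rewrite -subr_eq0 -mul_mx_scalar -mulmxBr; apply/eqP.
    by apply: psd_null_vector => //; rewrite linearB/= sA tr_scalar_mx.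
  apply/eqP => u0; move: uS; rewrite u0 /sqnorm big1 => [/eqP|i _].
    by rewrite eq_sym oner_eq0.
  by rewrite mxE expr0n.
move=> x; have := psd (\row_i x i).
have -> : (\row_i x i) 0 = x by apply/funext => i; rewrite mxE.
by rewrite quad_formB quad_form_scalar subr_ge0.
Qed.

Let eigenvalue_ge p (A : 'M[R]_p) (a b : R) : eigenvalue A b ->
  (forall x, a * \sum_i x i ^+ 2 <= quad_form A x) -> a <= b.
Proof.
move=> /eigenvalueP[v vA v0] /(_ (v 0)); rewrite quad_form_mx vA -scalemxAl mxE.
have -> : (v *m v^T) 0 0 = sqnorm v.
  by rewrite mxE; apply: eq_bigr => i _; rewrite mxE expr2.
by rewrite ler_pM2r// sqnorm_gt0.
Qed.

Lemma lambda_min_quad_form p (A : 'M[R]_p) x : (0 < p)%N -> A^T = A ->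
  lambda_min A * \sum_i x i ^+ 2 <= quad_form A x.
Proof.
move=> p0 sA; have [a Aa qa] := rayleigh p0 sA.
apply: (le_trans _ (qa x)); rewrite ler_wpM2r ?sumr_ge0// => [i _|].
  exact: sqr_ge0.
(* [inf] is meaningful only on a set bounded below; the Rayleigh eigenvalue [a] is itself a lower
   bound of the spectrum. *)
by apply: ge_inf => //; exists a => b Ab; exact: eigenvalue_ge qa.
Qed.

Lemma lambda_max_quad_form p (A : 'M[R]_p) x : (0 < p)%N -> A^T = A ->
  quad_form A x <= lambda_max A * \sum_i x i ^+ 2.
Proof.
move=> p0 sA.
have sNA : (- A)^T = - A by rewrite linearN/= sA.
have eigN (M : 'M[R]_p) (b : R) : eigenvalue M b -> eigenvalue (- M) (- b).
  move=> /eigenvalueP[v vM v0]; apply/eigenvalueP; exists v => //.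
  by rewrite mulmxN vM scaleNr.
have [a Aa qa] := rayleigh p0 sNA.
have := qa x; rewrite quad_formN lerNr -mulNr => /le_trans; apply.
rewrite ler_wpM2r ?sumr_ge0// => [i _|]; first exact: sqr_ge0.
apply: ub_le_sup; last by rewrite /= -[A]opprK; exact: eigN.
exists (- a) => b /eigN Ab; rewrite lerNr; exact: eigenvalue_ge qa.
Qed.

End rayleigh.

(** * Density of trigonometric polynomials *)

Section step_polynomials.
Context {R : realType}.

(** These polynomials come from an elementary proof of the Stone-Weierstrass theorem. With
    [x = (1 - y) / 2], the threshold [y = 0] is [x = 1 / 2], where [2 ^ n * x ^+ n] changes from
    vanishing to growing. The extra factor [n] in the exponent sends the value at the threshold
    itself to 0; without it the limit there would be [expR (-1)]. *)
Definition step_poly (n : nat) (y : R) : R :=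
  (1 - ((1 - y) / 2) ^+ n) ^+ (n * 2 ^ n).

Lemma bernoulli_ineq (x : R) n : -1 <= x -> 1 + n%:R * x <= (1 + x) ^+ n.
Proof.
move=> x1; elim: n => [|n IH]; first by rewrite mul0r addr0 expr0.
rewrite exprS; apply: (@le_trans _ _ ((1 + x) * (1 + n%:R * x))).
  have := sqr_ge0 x; have : 0 <= n%:R :> R by [].
  by rewrite -natr1; nra.
by rewrite ler_wpM2l//; lra.
Qed.

(** [1 - s ^+ n] is [1 - s] times a geometric sum of [n] terms, each at least [s ^+ n]. *)
Let natmul_expr_le (s : R) n : 0 <= s -> s <= 1 ->
  n%:R * (1 - s) * s ^+ n <= 1 - s ^+ n.
Proof.
move=> s0 s1; elim: n => [|n IH]; first by rewrite !mul0r expr0 subrr.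
have e0 : 0 <= s ^+ n by exact: exprn_ge0.
have e1 : s ^+ n <= 1 by exact: exprn_ile1.
have h1 : s * (n%:R * (1 - s) * s ^+ n) <= s * (1 - s ^+ n) by rewrite ler_wpM2l.
have h2 : (1 - s) * (s * s ^+ n) <= (1 - s) * 1.
  by rewrite ler_wpM2l ?subr_ge0// mulr_ile1.
rewrite exprS -natr1; move: h1 h2; move: (s ^+ n) (n%:R) => u v.
lra.
Qed.

(** Write [r = s * s]: one factor [s ^+ n] keeps [n%:R * s ^+ n] below [1 / (1 - s)], the other
    tends to 0. *)
Lemma cvg_natmul_expr (r : R) : 0 <= r -> r < 1 ->
  (n%:R * r ^+ n : R) @[n --> \oo] --> 0.
Proof.
move=> r0 r1; pose s := Num.sqrt r.
have s0 : 0 <= s by exact: sqrtr_ge0.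
have ss : s * s = r by rewrite -expr2 sqr_sqrtr.
have s1 : s < 1 by rewrite ltNge; apply/negP => h;
    have : 1 * 1 <= s * s by [rewrite ler_pM|]; rewrite ss; lra.
have cs : (s ^+ n / (1 - s) : R) @[n --> \oo] --> 0.
  rewrite -[X in _ --> X](mul0r (1 - s)^-1).
  by apply: cvgM; [apply: cvg_expr; rewrite ger0_norm|exact: cvg_cst].
apply: (squeeze_cvgr _ (cvg_cst 0) cs); apply: nearW => n.
rewrite mulr_ge0 ?exprn_ge0//= -ss exprMn mulrA mulrC ler_wpM2l ?exprn_ge0//.
rewrite -(@ler_pM2l _ (1 - s)) ?subr_gt0// mulfV ?gt_eqF ?subr_gt0//.
have := natmul_expr_le n s0 (ltW s1); have := exprn_ge0 n s0.
lra.
Qed.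

Lemma step_poly_ge0_le1 n (y : R) : -1 <= y -> y <= 1 ->
  0 <= step_poly n y /\ step_poly n y <= 1.
Proof.
move=> y1 y2.
have x0 : 0 <= (1 - y) / 2 by lra.
have x1 : (1 - y) / 2 <= 1 by lra.
have t0 := exprn_ge0 n x0; have t1 := exprn_ile1 n x0 x1.
by split; [rewrite exprn_ge0|rewrite exprn_ile1]; lra.
Qed.

Lemma cvg_step_poly (y : R) : -1 <= y -> y <= 1 ->
  step_poly n y @[n --> \oo] --> ((0 < y)%R%:R : R).
Proof.
move=> y1 y2; set x := (1 - y) / 2.
have x0 : 0 <= x by rewrite /x; lra.
have x1 : x <= 1 by rewrite /x; lra.
have [y0|y0] := ltrP 0 y; rewrite ?mulr1n ?mulr0n.
(* Bernoulli's inequality bounds the step polynomial below by [1 - n%:R * (2 * x) ^+ n], which tends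
   to 1. *)
- have x2 : 2 * x < 1 by rewrite /x; lra.
  have c1 : (1 - n%:R * (2 * x) ^+ n : R) @[n --> \oo] --> (1 : R).
    rewrite -[X in _ --> X]subr0; apply: cvgB; first exact: cvg_cst.
    by apply: cvg_natmul_expr => //; lra.
  have c2 : ((1 : R) @[_ --> \oo]) --> (1 : R) by exact: cvg_cst.
  apply: (squeeze_cvgr _ c1 c2); apply: nearW => n.
  rewrite (step_poly_ge0_le1 n y1 y2).2 andbT.
  rewrite /step_poly -/x [(2 * x) ^+ n]exprMn.
  have := @bernoulli_ineq (- x ^+ n) (n * 2 ^ n).
  rewrite lerN2 exprn_ile1// natrM natrX => /(_ isT) H.
  by apply: (le_trans _ H); lra.
(* With [t = x ^+ n] and [N = n * 2 ^ n], the product of [(1 - t) ^+ N] and [(1 + t) ^+ N] is at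
   most 1, while Bernoulli gives [(1 + t) ^+ N >= 1 + n%:R]. Hence the bound [harmonic n]. *)
- have x2 : 1 <= 2 * x by rewrite /x; lra.
  apply: (squeeze_cvgr _ (cvg_cst 0) cvg_harmonic); apply: nearW => n.
  rewrite (step_poly_ge0_le1 n y1 y2).1/= /harmonic /=.
  rewrite -[leRHS]mul1r ler_pdivlMr ?ltr0n//.
  have t0 := exprn_ge0 n x0; have t1 := exprn_ile1 n x0 x1.
  apply: (@le_trans _ _ (step_poly n y * (1 + x ^+ n) ^+ (n * 2 ^ n))).
    rewrite ler_wpM2l ?(step_poly_ge0_le1 n y1 y2).1//.
    apply: (le_trans _ (bernoulli_ineq _ _)); last by lra.
    rewrite natrM natrX -mulrA -exprMn -natr1.
    have h : 1 <= (2 * x) ^+ n by exact: exprn_ege1.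
    have : 0 <= n%:R :> R by [].
    by nra.
  rewrite /step_poly -/x -exprMn exprn_ile1//; nra.
Qed.

End step_polynomials.

(** * The algebra of trigonometric polynomials *)

Section trigonometric_polynomials.
Context {R : realType}.
Implicit Types (l : seq (R * R * R)) (x : R).

(* A triple (a, c, s) stands for the function a cos(c + s x). *)
Definition trig_poly l x : R := \sum_(t <- l) t.1.1 * cos (t.1.2 + t.2 * x).

Lemma trig_poly_measurable l : measurable_fun setT (trig_poly l).
Proof.
rewrite /trig_poly.
have := @measurable_sum _ _ R setT (R * R * R)%type l (fun t x =>
    t.1.1 * cos (t.1.2 + t.2 * x)).
apply => t; apply: measurable_funM => //; exact: cos_affine_measurable.
Qed.

Lemma trig_poly_bounded l : exists M, forall x, `|trig_poly l x| <= M.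
Proof.
exists (\sum_(t <- l) `|t.1.1|) => x.
apply: (le_trans (ler_norm_sum _ _ _)); apply: ler_sum => t _.
by rewrite normrM ler_piMr ?cos_max.
Qed.

Lemma trig_polyD l1 l2 x : trig_poly (l1 ++ l2) x = trig_poly l1 x + trig_poly l2 x.
Proof. by rewrite /trig_poly big_cat. Qed.

Lemma trig_polyZ (a : R) l :
  exists l', forall x, trig_poly l' x = a * trig_poly l x.
Proof.
exists [seq (a * t.1.1, t.1.2, t.2) | t <- l] => x.
by rewrite /trig_poly big_map mulr_sumr; apply: eq_bigr => t _; rewrite mulrA.
Qed.

Lemma trig_poly_cst (a : R) x : trig_poly [:: (a, 0, 0)] x = a.
Proof. by rewrite /trig_poly big_seq1 /= mul0r addr0 cos0 mulr1. Qed.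

(** By the product-to-sum formula. Closure under products is what keeps the step polynomials of a
    sine inside the family. *)
Lemma trig_polyM l1 l2 :
  exists l, forall x, trig_poly l x = trig_poly l1 x * trig_poly l2 x.
Proof.
elim: l1 => [|[[a c] s] l1 [l IH]].
  by exists [::] => x; rewrite /trig_poly big_nil mul0r.
exists ([seq (a * t.1.1 / 2, c + t.1.2, s + t.2) | t <- l2] ++
        [seq (a * t.1.1 / 2, c - t.1.2, s - t.2) | t <- l2] ++ l) => x.
have -> : trig_poly ((a, c, s) :: l1) x = a * cos (c + s * x) + trig_poly l1 x.
  by rewrite /trig_poly big_cons.
rewrite !trig_polyD IH mulrDl addrA.
congr (_ + _); rewrite /trig_poly !big_map /= mulr_sumr -big_split /=.
apply: eq_bigr => -[[b e] u] _ /=.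
have -> : c + e + (s + u) * x = (c + s * x) + (e + u * x) by ring.
have -> : c - e + (s - u) * x = (c + s * x) - (e + u * x) by ring.
by rewrite cosD cosB; field.
Qed.

Lemma trig_polyX l n : exists l', forall x, trig_poly l' x = trig_poly l x ^+ n.
Proof.
elim: n => [|n [l' IH]]; first by exists [:: (1, 0, 0)] => x; rewrite trig_poly_cst.
have [l2 H] := trig_polyM l l'.
by exists l2 => x; rewrite H IH exprS.
Qed.

Lemma step_poly_trig l n :
  exists l', forall x, trig_poly l' x = step_poly n (trig_poly l x).
Proof.
have [l1 h1] := trig_polyZ (- 2^-1) l.
have [l2 h2] := trig_polyX ([:: (2^-1, 0, 0)] ++ l1) n.
have [l3 h3] := trig_polyZ (-1) l2.
have [l4 h4] := trig_polyX ([:: (1, 0, 0)] ++ l3) (n * 2 ^ n).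
exists l4 => x; rewrite h4 trig_polyD trig_poly_cst h3 h2 trig_polyD trig_poly_cst h1.
by rewrite /step_poly; congr ((_ + _) ^+ _); rewrite mulN1r; congr (- (_ ^+ _)); field.
Qed.

Lemma sin_trig (c s : R) x : trig_poly [:: (1, c - pi / 2, s)] x = sin (c + s * x).
Proof.
rewrite /trig_poly big_seq1 /= mul1r addrAC cosB cos_pihalf sin_pihalf.
by rewrite mulr0 mulr1 add0r.
Qed.

End trigonometric_polynomials.

(** * Closure properties of mean-square approximation *)

Section density.
Context d (Omega : measurableType d) (R : realType) (P : probability Omega R).
Variables (Z : Omega -> R) (mZ : measurable_fun setT Z).
Implicit Types (f g h : R -> R).

Definition sq_dist f g : \bar R := (\int[P]_w ((f (Z w) - g (Z w)) ^+ 2)%:E)%E.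

Definition trig_approx f : Prop :=
  forall e : R, 0 < e -> exists l, (sq_dist f (trig_poly l) <= e%:E)%E.

Let measurable_sq f g : measurable_fun setT f -> measurable_fun setT g ->
  measurable_fun setT (fun w => ((f (Z w) - g (Z w)) ^+ 2)%:E).
Proof.
move=> mf mg; apply/measurable_EFinP; apply: measurable_funX.
by apply: measurable_funB; exact: measurableT_comp.
Qed.

(** From [(u + v) ^+ 2 <= 2 * (u ^+ 2 + v ^+ 2)]. The factor 2 is the price of working with squared
    distances, and the reason for the tolerances [e / 4] in the closure lemmas. *)
Let sq_dist_triangle f g h : measurable_fun setT f -> measurable_fun setT g ->
  measurable_fun setT h ->
  (sq_dist f h <= 2%:E * (sq_dist f g + sq_dist g h))%E.
Proof.
move=> mf mg mh; rewrite /sq_dist -ge0_integralD//; last 4 first.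
- by move=> w _; rewrite lee_fin sqr_ge0.
- exact: measurable_sq.
- by move=> w _; rewrite lee_fin sqr_ge0.
- exact: measurable_sq.
rewrite -ge0_integralZl//; last 2 first.
- by apply: emeasurable_funD; exact: measurable_sq.
- by move=> w _; rewrite -EFinD lee_fin addr_ge0 ?sqr_ge0.
apply: ge0_le_integral => //.
- by move=> w _; rewrite lee_fin sqr_ge0.
- exact: measurable_sq.
- apply: measurable_funeM; apply: emeasurable_funD; exact: measurable_sq.
- move=> w _; rewrite -EFinD -EFinM lee_fin.
  by have := sqr_ge0 (f (Z w) - g (Z w) - (g (Z w) - h (Z w))); nra.
Qed.

Lemma trig_approx_poly l : trig_approx (trig_poly l).
Proof.
move=> e e0; exists l; rewrite /sq_dist.
by under eq_integral do rewrite subrr expr0n; rewrite integral0 lee_fin ltW.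
Qed.

Lemma trig_approx_limit f : measurable_fun setT f ->
  (forall e : R, 0 < e -> exists g, [/\ measurable_fun setT g, trig_approx g &
    (sq_dist f g <= e%:E)%E]) -> trig_approx f.
Proof.
move=> mf H e e0.
have e4 : 0 < e / 4 by rewrite divr_gt0.
have [g [mg ag fg]] := H _ e4; have [l gl] := ag _ e4; exists l.
apply: (le_trans (sq_dist_triangle mf mg (trig_poly_measurable l))).
apply: (@le_trans _ _ (2%:E * ((e / 4)%:E + (e / 4)%:E))%E).
  by rewrite lee_wpmul2l ?lee_fin// leeD.
by rewrite -EFinD -EFinM lee_fin; lra.
Qed.

Lemma trig_approx_dominated (g_ : nat -> R -> R) f h :
  measurable_fun setT f -> measurable_fun setT h ->
  (forall n, measurable_fun setT (g_ n)) -> (forall n, trig_approx (g_ n)) ->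
  (forall x, g_ n x @[n --> \oo] --> f x) ->
  (forall n x, `|f x - g_ n x| <= h x) ->
  (\int[P]_w (h (Z w) ^+ 2)%:E < +oo)%E -> trig_approx f.
Proof.
move=> mf mh mg ag cg fgh ih; apply: trig_approx_limit => // e e0.
have mh2 : measurable_fun setT (fun w => (h (Z w) ^+ 2)%:E).
  by apply/measurable_EFinP; apply: measurable_funX; exact: measurableT_comp.
have c0 : (sq_dist f (g_ n) @[n --> \oo] --> \int[P]_w (cst 0 w))%E.
  apply: (@dominated_cvg _ _ _ P setT measurableT _ _ (fun w => (h (Z w) ^+ 2)%:E)).
  - by move=> n; exact: measurable_sq.
  - move=> w _; apply: cvg_EFin; first exact: nearW.
    rewrite /= -[X in _ --> X](_ : (f (Z w) - f (Z w)) ^+ 2 = 0); last first.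
      by rewrite subrr expr0n.
    rewrite expr2; under eq_fun do rewrite expr2.
    by apply: cvgM; (apply: cvgB; [exact: cvg_cst|exact: cg]).
  - by [].
  - apply/integrableP; split => //.
    by under eq_integral do rewrite /= ger0_norm ?sqr_ge0//.
  - move=> n w _; rewrite lee_fin ger0_norm ?sqr_ge0//.
    rewrite -(@real_normK _ (f (Z w) - _)) ?num_real// ler_pXn2r// nnegrE//.
    exact: le_trans (fgh n _).
move: c0; rewrite integral0 => /fine_cvgP[_ /cvgrPdist_le/(_ e e0)] c0.
have [n [fn ne]] : exists n, sq_dist f (g_ n) \is a fin_num /\
    `|0 - fine (sq_dist f (g_ n))| <= e.
  near \oo => n; exists n; split; last by near: n.
  rewrite ge0_fin_numE; last by apply: integral_ge0 => w _; rewrite lee_fin sqr_ge0.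
  apply: le_lt_trans ih; apply: ge0_le_integral => //.
  - by move=> w _; rewrite lee_fin sqr_ge0.
  - exact: measurable_sq.
  - move=> w _; rewrite lee_fin.
    rewrite -(@real_normK _ (f (Z w) - _)) ?num_real// ler_pXn2r// nnegrE//.
    exact: le_trans (fgh n _).
exists (g_ n); split => //.
rewrite -(fineK fn) lee_fin; move: ne; rewrite sub0r normrN.
by apply: le_trans; exact: ler_norm.
Unshelve. all: by end_near. Qed.

Lemma trig_approx_bounded (g_ : nat -> R -> R) f (M : R) :
  measurable_fun setT f ->
  (forall n, measurable_fun setT (g_ n)) -> (forall n, trig_approx (g_ n)) ->
  (forall x, g_ n x @[n --> \oo] --> f x) ->
  (forall n x, `|f x - g_ n x| <= M) -> trig_approx f.
Proof.
move=> mf mg ag cg fgM; apply: (trig_approx_dominated _ _ mg ag cg fgM) => //.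
by rewrite integral_cst// [X in (_ * X)%E]probability_setT mule1 ltry.
Qed.

Lemma trig_approxD f g : measurable_fun setT f -> measurable_fun setT g ->
  trig_approx f -> trig_approx g -> trig_approx (f \+ g).
Proof.
move=> mf mg af ag e e0.
have e4 : 0 < e / 4 by rewrite divr_gt0.
have [l1 fl] := af _ e4; have [l2 gl] := ag _ e4; exists (l1 ++ l2).
have ml1 := trig_poly_measurable l1; have ml2 := trig_poly_measurable l2.
apply: (le_trans (sq_dist_triangle (g := f \+ trig_poly l2) _ _ _)).
- exact: measurable_funD.
- exact: measurable_funD.
- exact: trig_poly_measurable.
have -> : sq_dist (f \+ g) (f \+ trig_poly l2) = sq_dist g (trig_poly l2).
  by apply: eq_integral => w _ /=; congr (_ ^+ 2)%:E; ring.
have -> : sq_dist (f \+ trig_poly l2) (trig_poly (l1 ++ l2)) = sq_dist f (trig_poly l1).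
  by apply: eq_integral => w _ /=; rewrite trig_polyD; congr (_ ^+ 2)%:E; ring.
apply: (@le_trans _ _ (2%:E * ((e / 4)%:E + (e / 4)%:E))%E).
  by rewrite lee_wpmul2l ?lee_fin// leeD.
by rewrite -EFinD -EFinM lee_fin; lra.
Qed.

Lemma trig_approxZ (a : R) f : measurable_fun setT f ->
  trig_approx f -> trig_approx (fun x => a * f x).
Proof.
move=> mf af e e0.
have a1 : 0 < a ^+ 2 + 1 by rewrite ltr_wpDl ?sqr_ge0.
(* The denominator is [a ^+ 2 + 1] and not [a ^+ 2], so that [a = 0] needs no separate case. *)
have e1 : 0 < e / (a ^+ 2 + 1) by rewrite divr_gt0.
have [l fl] := af _ e1; have [l' al] := trig_polyZ a l; exists l'.
have -> : sq_dist (fun x => a * f x) (trig_poly l') =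
    ((a ^+ 2)%:E * sq_dist f (trig_poly l))%E.
  rewrite /sq_dist -ge0_integralZl//; last 3 first.
  - by apply: measurable_sq => //; exact: trig_poly_measurable.
  - by move=> w _; rewrite lee_fin sqr_ge0.
  - by rewrite lee_fin sqr_ge0.
  by apply: eq_integral => w _; rewrite al -EFinM -exprMn; congr (_ ^+ 2)%:E; ring.
apply: (@le_trans _ _ ((a ^+ 2)%:E * (e / (a ^+ 2 + 1))%:E)%E).
  by rewrite lee_wpmul2l ?lee_fin ?sqr_ge0.
rewrite -EFinM lee_fin mulrCA ler_piMr ?(ltW e0)// ler_pdivrMr// mul1r.
by rewrite lerDl.
Qed.

Lemma trig_approx_sum (I : Type) (r : seq I) (F : I -> R -> R) :
  (forall i, measurable_fun setT (F i)) -> (forall i, trig_approx (F i)) ->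
  trig_approx (fun x => \sum_(i <- r) F i x).
Proof.
move=> mF aF; elim: r => [|i r IH].
  rewrite (_ : (fun x => _) = trig_poly [:: (0, 0, 0)]).
    exact: trig_approx_poly.
  by apply/funext => x; rewrite big_nil trig_poly_cst.
rewrite (_ : (fun x => _) = F i \+ (fun x => \sum_(i <- r) F i x)).
  by apply: trig_approxD => //; exact: measurable_sum.
by apply/funext => x; rewrite big_cons.
Qed.

End density.

(** * From half-lines to all square-integrable functions *)

Section density_L2.
Context d (Omega : measurableType d) (R : realType) (P : probability Omega R).
Variables (Z : Omega -> R) (mZ : measurable_fun setT Z).
Notation approx := (trig_approx P Z).

Let indic_setC (S : set R) :
  \1_(~` S) = (cst 1 \+ (fun x => -1 * \1_S x)) :> (R -> R).
Proof.
apply/funext => x /=; rewrite !indicE in_setC.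
by case: (x \in S); rewrite ?mulr1n ?mulr0n ?mulr1 ?mulr0 ?addr0 ?subrr.
Qed.

Let norm_boolB (b c : bool) : `|b%:R - c%:R| <= 1 :> R.
Proof.
by case: b; case: c; rewrite /= ?mulr1n ?mulr0n ?subrr ?subr0 ?sub0r ?normrN ?normr0
    ?normr1.
Qed.

Let approx_cst (a : R) : approx (cst a).
Proof.
rewrite (_ : cst a = trig_poly [:: (a, 0, 0)]); first exact: trig_approx_poly.
by apply/funext => x; rewrite trig_poly_cst.
Qed.

Let sin_pos (a b x : R) : R := (0 < sin (a + b * x))%R%:R.

Let measurable_sin_pos (a b : R) : measurable_fun setT (sin_pos a b).
Proof.
have msin : measurable_fun setT (fun x : R => sin (a + b * x)).
  apply: measurableT_comp; first by apply: continuous_measurable_fun;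
      exact: continuous_sin.
  by apply: measurable_funD => //; apply: measurable_funM.
rewrite (_ : sin_pos a b = \1_((fun x : R => sin (a + b * x)) @^-1` `]0, +oo[%classic)).
  by apply: measurable_indic; rewrite -[X in measurable X]setTI; exact: msin.
apply/funext => x; rewrite indicE /sin_pos; congr (_ %:R).
by congr nat_of_bool; apply/idP/idP; rewrite inE /= in_itv /= andbT.
Qed.

(* The step polynomials in a sine increase the contrast between the half-periods
   where the sine is positive and those where it is not. *)
Let approx_sin_pos (a b : R) : approx (sin_pos a b).
Proof.
pose l : seq (R * R * R) := [:: (1, a - pi / 2, b)].
pose l_ n := sval (cid (step_poly_trig l n)).
have lE n x : trig_poly (l_ n) x = step_poly n (sin (a + b * x)).
  by rewrite /l_; case: cid => l' /= ->; rewrite sin_trig.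
apply: (trig_approx_bounded mZ _ (fun n => trig_poly_measurable (l_ n))
   (fun n => trig_approx_poly P Z (l_ n)) (M := 1)).
- exact: measurable_sin_pos.
- move=> x; under eq_fun do rewrite lE.
  by apply: cvg_step_poly; [exact: sin_geN1|exact: sin_le1].
- move=> n x; rewrite lE /sin_pos.
  have [h1 h2] := step_poly_ge0_le1 n (sin_geN1 (a + b * x)) (sin_le1 (a + b * x)).
  by rewrite ler_norml; case: (0 < _)%R; rewrite ?mulr1n ?mulr0n; lra.
Qed.

(* A half-line is the limit of such half-periods as the period grows. *)
Let approx_half_line (a : R) : approx \1_(`]a, +oo[%classic).
Proof.
pose g n := sin_pos (- a / n.+1%:R) n.+1%:R^-1.
apply: (trig_approx_bounded mZ (g_ := g) (M := 1)).
- by apply: measurable_indic; exact: measurable_itv.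
- by move=> n; exact: measurable_sin_pos.
- by move=> n; exact: approx_sin_pos.
- move=> x; apply: cvg_near_cst; near=> n.
  have n0 : 0 < n.+1%:R :> R by rewrite ltr0n.
  have nx : `|x - a| < n.+1%:R.
    apply: (@lt_trans _ _ n%:R); last by rewrite ltr_nat.
    by near: n; exact: nbhs_infty_gtr.
  rewrite /g /sin_pos (_ : _ + _ = (x - a) / n.+1%:R); last by ring.
  have tx : `|(x - a) / n.+1%:R| < 1.
    by rewrite normrM normfV (gtr0_norm n0) ltr_pdivrMr// mul1r.
  rewrite indicE; congr (_ %:R); congr nat_of_bool.
  have -> : (x \in `]a, +oo[%classic) = (a < x).
    by apply/idP/idP; rewrite inE /= in_itv /= andbT.
  have tpos : 0 < x - a -> 0 < (x - a) / n.+1%:R by move=> h; rewrite divr_gt0.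
  have tneg : x - a <= 0 -> (x - a) / n.+1%:R <= 0 by move=> h;
      rewrite ler_pdivrMr ?mul0r.
  move: tx tpos tneg; rewrite ltr_norml => /andP[]; move: (_ / _) => t t1 t2 tpos tneg.
  have [ax|xa] := ltrP a x.
    by apply: sin2_gt0; rewrite tpos ?subr_gt0//=; lra.
  have {}tneg : t <= 0 by rewrite tneg// subr_le0.
  apply/negP/negP; rewrite -leNgt.
  have [->|t0] := eqVneq t 0; first by rewrite sin0.
  have : 0 < sin (- t).
    by apply: sin2_gt0; rewrite oppr_gt0 lt_neqAle t0 tneg/=; lra.
  by rewrite sinN oppr_gt0 => /ltW.
- by move=> n x; exact: norm_boolB.
Unshelve. all: by end_near. Qed.

(** Dynkin's theorem: open half-lines are stable under intersection and generate the Borel sets, and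
    the approximable sets are stable under complement and countable disjoint union. A disjoint union
    is reached through its finite parts, whose indicators are sums of indicators. *)
Let approx_indic (S : set R) : measurable S -> approx \1_S.
Proof.
have mE : @measurable _ R = <<s @RGenOInfty.G R >> by exact: RGenOInfty.measurableE.
move=> mS; apply: (@dynkin_induction _ R (@RGenOInfty.G R) (fun S => approx \1_S) mE).
- move=> _ _ [a ->] [b ->]; exists (Num.max a b); apply/seteqP.
  split=> x /=; rewrite !in_itv/= !andbT gt_max.
    by move=> [-> ->].
  by move=> /andP[].
- rewrite (_ : \1__ = cst 1); first exact: approx_cst.
  by rewrite indicT.
- by move=> _ [a ->]; exact: approx_half_line.
- move=> A mA aA; rewrite indic_setC; apply: trig_approxD => //.
  + by apply: measurable_funM => //; exact: measurable_indic.
  + by apply: trig_approxZ => //; exact: measurable_indic.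
- move=> F mF tF aF.
  pose U n := \big[setU/set0]_(k < n) F k.
  have mU n : measurable (U n) by exact: bigsetU_measurable.
  have aU n : approx \1_(U n).
    elim: n => [|n IH].
      by rewrite /U big_ord0 indic0; exact: approx_cst.
    have -> : \1_(U n.+1) = \1_(U n) \+ \1_(F n) :> (R -> R).
      have tF' : trivIset xpredT F by move=> i j _ _; exact: tF.
      have /seteqP[UF _] := @trivIset_bigsetUI _ xpredT F tF' n n isT (leqnn n).
      apply/funext => x; rewrite /U big_ord_recr/= !indicE in_setU -natrD -/(U n).
      case: (boolP (x \in U n)) => //; rewrite ?inE => Ux.
      case: (boolP (x \in F n)) => //; rewrite inE => Fx.
      by have := UF x; case.
    apply: trig_approxD => //; exact: measurable_indic.
  apply: (trig_approx_bounded mZ (g_ := fun n => \1_(U n)) (M := 1)) => //.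
  + by apply: measurable_indic; exact: bigcupT_measurable.
  + move=> x; apply: cvg_near_cst.
    have [[k _ Fk]|nF] := pselect ((\bigcup_k F k) x).
      near=> n; rewrite !indicE !mem_set//; first by exists k.
      rewrite /U -bigcup_mkord; exists k => //=.
      by near: n; exact: nbhs_infty_gt.
    apply: nearW => n; rewrite !indicE !memNset// => Ux.
    exact/nF/(bigsetU_bigcup Ux).
  + by move=> n x; exact: norm_boolB.
- by rewrite -mE.
Unshelve. all: by end_near. Qed.

Import HBNNSimple.

Let approx_simple (f : {nnsfun R >-> R}) : approx f.
Proof.
have [s fE] : exists s : seq R,
    forall x, f x = \sum_(y <- s) y * \1_(f @^-1` [set y]) x.
  by eexists => x; rewrite fimfunE fsbig_finite//=.
rewrite (_ : (f : R -> R) = (fun x => \sum_(y <- s) y * \1_(f @^-1` [set y]) x)).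
  apply: trig_approx_sum => // y.
    by apply: measurable_funM => //; exact: measurable_indic.
  apply: trig_approxZ => //.
  exact: approx_indic.
exact/funext.
Qed.

(** Simple functions increase to [h], so the error stays between 0 and [h], and [h] itself serves as
    the dominating function. *)
Let approx_ge0 (h : R -> R) : measurable_fun setT h -> (forall x, 0 <= h x) ->
  (\int[P]_w (h (Z w) ^+ 2)%:E < +oo)%E -> approx h.
Proof.
move=> mh h0 ih.
have mh' : measurable_fun setT (EFin \o h) by exact/measurable_EFinP.
pose g := nnsfun_approx measurableT mh'.
have cg x : g n x @[n --> \oo] --> h x.
  have : (EFin \o g^~ x @ \oo --> (h x)%:E)%E.
    by apply: (cvg_nnsfun_approx measurableT mh') => // y _; rewrite lee_fin.
  by move/fine_cvg.
have gle n x : g n x <= h x.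
  have nd : nondecreasing_seq (g^~ x).
    by move=> m k mk; have /lefP/(_ x) := nd_nnsfun_approx measurableT mh' mk.
  by have := nondecreasing_cvgn_le nd (cvgP _ (cg x)) n; rewrite (cvg_lim _ (cg x)).
apply: (trig_approx_dominated mZ mh mh _ _ cg _ ih).
- by move=> n; exact: measurable_funP.
- by move=> n; exact: approx_simple.
- move=> n x; rewrite ger0_norm ?subr_ge0// lerBlDr lerDl.
  exact: fun_ge0.
Qed.

Lemma trig_approx_Lfun2 (h : R -> R) : measurable_fun setT h ->
  h \o Z \in Lfun P 2%:E -> approx h.
Proof.
move=> mh /Lfun2_integrable_sqr/integrableP[mhZ].
under eq_integral do rewrite /= ger0_norm ?sqr_ge0//.
move=> ih.
have mhZ' : measurable_fun setT (h \o Z) by exact: measurableT_comp.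
have max_sqr (a : R) : Num.max a 0 ^+ 2 <= a ^+ 2.
  by have [a0|a0] := lerP a 0; [rewrite expr0n sqr_ge0|].
have bound (k : R -> R) : measurable_fun setT k ->
    (forall x, k x ^+ 2 <= h x ^+ 2) -> (\int[P]_w (k (Z w) ^+ 2)%:E < +oo)%E.
  move=> mk kh; apply: le_lt_trans ih; apply: ge0_le_integral => //.
  - by move=> w _; rewrite lee_fin sqr_ge0.
  - by apply/measurable_EFinP; apply: measurable_funX; exact: measurableT_comp.
  - by move=> w _; rewrite lee_fin.
have mp : measurable_fun setT (fun x => Num.max (h x) 0).
  exact: measurable_maxr.
have mn : measurable_fun setT (fun x => Num.max (- h x) 0).
  by apply: measurable_maxr => //; exact: measurableT_comp.
have ap : approx (fun x => Num.max (h x) 0).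
  apply: approx_ge0 => //; first by move=> x; rewrite le_max lexx orbT.
  by apply: (bound (fun x => Num.max (h x) 0)) => // x; exact: max_sqr.
have an : approx (fun x => Num.max (- h x) 0).
  apply: approx_ge0 => //; first by move=> x; rewrite le_max lexx orbT.
  by apply: (bound (fun x => Num.max (- h x) 0)) => // x;
      rewrite (le_trans (max_sqr _))// sqrrN.
rewrite (_ : h = (fun x => Num.max (h x) 0) \+ (fun x => -1 * Num.max (- h x) 0)).
  apply: trig_approxD => //; first exact: measurable_funM.
  exact: trig_approxZ.
apply/funext => x /=; have [h0|h0] := lerP (h x) 0.
  by rewrite max_l ?oppr_ge0//; ring.
by rewrite max_r ?oppr_le0 1?ltW//; ring.
Qed.

End density_L2.

(** * Covariances *)

Section real_covariance.
Context d (Omega : measurableType d) (R : realType) (P : probability Omega R).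
Implicit Types X Y : Omega -> R.
Local Notation L2 := (Lfun P 2%:E).

Definition rcov X Y : R := fine (covariance P X Y).

Let Lfun12 X : X \in L2 -> X \in Lfun P 1.
Proof. by apply: Lfun_subset12; exact: fin_num_measure. Qed.

Lemma EFin_rcov X Y : X \in L2 -> Y \in L2 -> covariance P X Y = (rcov X Y)%:E.
Proof.
move=> X2 Y2; rewrite fineK// covariance_fin_num//; [exact: Lfun12..|].
exact: Lfun2_mul_Lfun1.
Qed.

Lemma rcovE X Y : X \in L2 -> Y \in L2 ->
  rcov X Y = \int[P]_w (X w * Y w) - \int[P]_w X w * \int[P]_w Y w.
Proof.
move=> X2 Y2; rewrite /rcov (covarianceE (Lfun12 X2) (Lfun12 Y2)
    (Lfun2_mul_Lfun1 X2 Y2)).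
have fX := expectation_fin_num (Lfun12 X2).
have fY := expectation_fin_num (Lfun12 Y2).
have fXY := expectation_fin_num (Lfun2_mul_Lfun1 X2 Y2).
by rewrite fineB ?fin_numM// (fineM fX fY) unlock.
Qed.

Lemma rcovC X Y : rcov X Y = rcov Y X.
Proof. by rewrite /rcov covarianceC. Qed.

Lemma rcovDl X1 X2 Y : X1 \in L2 -> X2 \in L2 -> Y \in L2 ->
  rcov (fun w => X1 w + X2 w) Y = rcov X1 Y + rcov X2 Y.
Proof.
move=> l1 l2 lY; rewrite /rcov [X in fine X](covarianceDl l1 l2 lY).
by rewrite !EFin_rcov.
Qed.

Lemma rcovZl a X Y : X \in L2 -> Y \in L2 ->
  rcov (fun w => a * X w) Y = a * rcov X Y.
Proof.
move=> lX lY; have -> : (fun w => a * X w) = a \o* X.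
  by apply/funext => w /=; rewrite mulrC.
rewrite /rcov (covarianceZl _ (Lfun12 lX) (Lfun12 lY) (Lfun2_mul_Lfun1 lX lY)).
by rewrite EFin_rcov.
Qed.

Lemma Lfun2Z a X : X \in L2 -> (fun w => a * X w) \in L2.
Proof.
move=> lX; have -> : (fun w => a * X w) = a \o* X.
  by apply/funext => w /=; rewrite mulrC.
by apply: Lfun_scale => //; rewrite ler1n.
Qed.

Lemma Lfun2D X Y : X \in L2 -> Y \in L2 -> (fun w => X w + Y w) \in L2.
Proof. by move=> lX lY; rewrite (_ : (fun w => _) = X + Y)// rpredD ?lee1n. Qed.

Lemma Lfun2_cst (a : R) : (fun _ : Omega => a) \in L2.
Proof. exact: Lfun_cst. Qed.

Lemma Lfun2_sum (I : Type) (r : seq I) (F : I -> Omega -> R) :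
  (forall i, F i \in L2) -> (fun w => \sum_(i <- r) F i w) \in L2.
Proof.
move=> FL; elim: r => [|i r IH].
  by under eq_fun do rewrite big_nil; exact: Lfun2_cst.
by under eq_fun do rewrite big_cons; exact: Lfun2D.
Qed.

Lemma rcov_suml (I : Type) (r : seq I) (F : I -> Omega -> R) Y :
  (forall i, F i \in L2) -> Y \in L2 ->
  rcov (fun w => \sum_(i <- r) F i w) Y = \sum_(i <- r) rcov (F i) Y.
Proof.
move=> FL YL; elim: r => [|i r IH].
  under eq_fun do rewrite big_nil.
  by rewrite big_nil /rcov covariance_cst_l.
under eq_fun do rewrite big_cons.
by rewrite big_cons -IH rcovDl//; exact: Lfun2_sum.
Qed.

Lemma rcov_sum (I J : Type) (r : seq I) (s : seq J)
    (F : I -> Omega -> R) (G : J -> Omega -> R) :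
  (forall i, F i \in L2) -> (forall j, G j \in L2) ->
  rcov (fun w => \sum_(i <- r) F i w) (fun w => \sum_(j <- s) G j w) =
  \sum_(i <- r) \sum_(j <- s) rcov (F i) (G j).
Proof.
move=> FL GL; rewrite rcov_suml//; last exact: Lfun2_sum.
apply: eq_bigr => i _; rewrite rcovC rcov_suml//.
by apply: eq_bigr => j _; rewrite rcovC.
Qed.

Lemma rvar_ge0 X : 0 <= rcov X X.
Proof. by rewrite /rcov fine_ge0//; exact: variance_ge0. Qed.

Lemma rvar_le_sqr X (e : R) : X \in L2 ->
  (\int[P]_w (X w ^+ 2)%:E <= e%:E)%E -> rcov X X <= e.
Proof.
move=> lX Xe; rewrite rcovE//; apply: (@le_trans _ _ (\int[P]_w (X w * X w))).
  by rewrite lerBlDr lerDl -expr2 sqr_ge0.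
rewrite -lee_fin /Rintegral fineK.
  by apply: le_trans Xe; under eq_integral do rewrite -expr2.
exact: integrable_fin_num (Lfun2_mul_integrable lX lX).
Qed.

(** The one-sided bound [covariance_le], used for [X] and for its opposite. *)
Lemma rcov_cauchy_schwarz X Y : X \in L2 -> Y \in L2 ->
  `|rcov X Y| <= Num.sqrt (rcov X X) * Num.sqrt (rcov Y Y).
Proof.
move=> lX lY.
have H (X' Y' : Omega -> R) : X' \in L2 -> Y' \in L2 ->
    rcov X' Y' <= Num.sqrt (rcov X' X') * Num.sqrt (rcov Y' Y').
  move=> lX' lY'; have := covariance_le lX' lY'.
  by rewrite /variance !EFin_rcov// /= -EFinM lee_fin.
rewrite ler_norml H// andbT lerNl.
have := H _ _ (Lfun2Z (-1) lX) lY.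
by rewrite !rcovZl ?Lfun2Z// [rcov X (fun w =>
    -1 * _)]rcovC rcovZl// mulrA mulrNN mulr1 mul1r mulN1r.
Qed.

(** Covariance is bilinear, and Cauchy-Schwarz controls each error term. The rate is the square of
    [harmonic n] so that the errors have standard deviation at most [harmonic n]. *)
Lemma cvg_rcov (A_ B_ : nat -> Omega -> R) (A B : Omega -> R) :
  (forall n, A_ n \in L2) -> (forall n, B_ n \in L2) -> A \in L2 -> B \in L2 ->
  (forall n, (\int[P]_w ((A_ n w - A w) ^+ 2)%:E <= (harmonic n ^+ 2)%:E)%E) ->
  (forall n, (\int[P]_w ((B_ n w - B w) ^+ 2)%:E <= (harmonic n ^+ 2)%:E)%E) ->
  rcov (A_ n) (B_ n) @[n --> \oo] --> rcov A B.
Proof.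
move=> lA_ lB_ lA lB cA cB.
pose DA n w := A_ n w + -1 * A w; pose DB n w := B_ n w + -1 * B w.
have lDA n : DA n \in L2 by apply: Lfun2D => //; exact: Lfun2Z.
have lDB n : DB n \in L2 by apply: Lfun2D => //; exact: Lfun2Z.
have small (D : Omega -> R) n : D \in L2 ->
    (\int[P]_w (D w ^+ 2)%:E <= (harmonic n ^+ 2)%:E)%E ->
    Num.sqrt (rcov D D) <= harmonic n.
  move=> lD De.
  have h0 : 0 <= harmonic n :> R by rewrite /harmonic /= invr_ge0.
  rewrite -[leRHS](ger0_norm h0) -[leRHS]sqrtr_sqr ler_sqrt ?sqr_ge0//.
  exact: rvar_le_sqr.
have sA n : Num.sqrt (rcov (DA n) (DA n)) <= harmonic n.
  by apply: small => //; under eq_integral do rewrite /DA mulN1r; exact: cA.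
have sB n : Num.sqrt (rcov (DB n) (DB n)) <= harmonic n.
  by apply: small => //; under eq_integral do rewrite /DB mulN1r; exact: cB.
have eq n : rcov (A_ n) (B_ n) =
    rcov A B + rcov A (DB n) + rcov (DA n) B + rcov (DA n) (DB n).
  have -> : A_ n = (fun w => A w + DA n w).
    by apply/funext => w; rewrite /DA; ring.
  have -> : B_ n = (fun w => B w + DB n w).
    by apply/funext => w; rewrite /DB; ring.
  rewrite rcovDl//; last exact: Lfun2D.
  rewrite rcovC rcovDl// (rcovC _ (fun w => B w + _)) rcovDl//.
  by rewrite (rcovC B A) (rcovC (DB n) A) (rcovC B (DA n)) (rcovC (DB n) (DA n)) !addrA.
(* One summand for each error term; the 1 is for the product of the two errors, at most
   [harmonic n ^+ 2] and hence at most [harmonic n]. *)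
pose K : R := Num.sqrt (rcov A A) + Num.sqrt (rcov B B) + 1.
apply/subr_cvg0; apply/norm_cvg0P.
have cK : (K * harmonic n : R) @[n --> \oo] --> (0 : R).
  by rewrite -[X in _ --> X](mulr0 K); apply: cvgMl_tmp; exact: cvg_harmonic.
apply: (squeeze_cvgr _ (cvg_cst 0) cK); apply: nearW => n.
rewrite normr_ge0 eq /=.
rewrite (_ : _ - _ = rcov A (DB n) + rcov (DA n) B + rcov (DA n) (DB n)); last by ring.
have h0 : 0 <= harmonic n :> R by rewrite /harmonic /= invr_ge0.
have h1 : harmonic n <= 1 :> R by rewrite /harmonic /= invf_le1// ler1n.
rewrite /K !mulrDl mul1r; apply: (le_trans (ler_normD _ _)); apply: lerD.
  apply: (le_trans (ler_normD _ _)); apply: lerD.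
    by apply: (le_trans (rcov_cauchy_schwarz lA (lDB n))); rewrite ler_wpM2l.
  apply: (le_trans (rcov_cauchy_schwarz (lDA n) lB)); rewrite mulrC ler_wpM2l//.
apply: (le_trans (rcov_cauchy_schwarz (lDA n) (lDB n))).
by rewrite -[leRHS]mulr1 ler_pM// (le_trans (sB n)).
Qed.

End real_covariance.

(** * The covariance of two cosines as a power series in the correlation *)

Section cosine_covariance_series.
Context {R : realType}.

(* Up to sign, k! times the k-th coefficient, in the Hermite expansion, of
   z |-> cos (c + x z) under the standard Gaussian law. *)
Definition hermite_coef (k : nat) (x c : R) : R :=
  x ^+ k * expR (- (x ^+ 2 / 2)) * (if odd k then sin c else cos c).

Let cvg_exp_coeffS (z : R) :
  (\sum_(0 <= k < n) exp_coeff z k.+1 : R) @[n --> \oo] --> expR z - 1.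
Proof.
have cz : series (exp_coeff z) @ \oo --> expR z by exact: is_cvg_series_exp_coeff.
have cz1 : series (exp_coeff z) n.+1 @[n --> \oo] --> expR z.
  by rewrite (cvg_shiftS (series (exp_coeff z))).
have -> : (fun n => \sum_(0 <= k < n) exp_coeff z k.+1) =
    (fun n => series (exp_coeff z) n.+1 - 1).
  apply/funext => n; rewrite /series /= big_nat_recl//.
  by rewrite {2}/exp_coeff /= expr0 fact0 divr1 addrAC subrr add0r.
by apply: cvgB => //; exact: cvg_cst.
Qed.

(** A form of Mehler's formula. With [z = r * x * y], the limit is a combination of [expR (- z) - 1]
    and [expR z - 1]: subtracting the product of the means removes the constant terms, so the series
    starts at exponent 1. *)
Lemma cvg_cos_covariance (r x y c e : R) :
  (\sum_(0 <= k < n) r ^+ k.+1 / k.+1`!%:R *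
     (hermite_coef k.+1 x c * hermite_coef k.+1 y e) : R) @[n --> \oo] -->
  (cos (c + e) * expR (- ((x ^+ 2 + 2 * (r * x * y) + y ^+ 2) / 2)) +
   cos (c - e) * expR (- ((x ^+ 2 - 2 * (r * x * y) + y ^+ 2) / 2))) / 2 -
  cos c * expR (- (x ^+ 2 / 2)) * (cos e * expR (- (y ^+ 2 / 2))).
Proof.
set z := r * x * y.
pose K := expR (- (x ^+ 2 / 2)) * expR (- (y ^+ 2 / 2)).
have -> : - ((x ^+ 2 + 2 * z + y ^+ 2) / 2) =
  - (x ^+ 2 / 2) + - (y ^+ 2 / 2) + - z by field.
have -> : - ((x ^+ 2 - 2 * z + y ^+ 2) / 2) =
  - (x ^+ 2 / 2) + - (y ^+ 2 / 2) + z by field.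
rewrite ![expR (_ + _ + _)]expRD [expR (- (x ^+ 2 / 2) + _)]expRD -/K.
have -> : (cos (c + e) * (K * expR (- z)) + cos (c - e) * (K * expR z)) / 2 -
    cos c * expR (- (x ^+ 2 / 2)) * (cos e * expR (- (y ^+ 2 / 2))) =
    K / 2 * cos (c + e) * (expR (- z) - 1) + K / 2 * cos (c - e) * (expR z - 1).
  by rewrite /K cosD cosB; field.
have -> : (fun n => \sum_(0 <= k < n) r ^+ k.+1 / k.+1`!%:R *
     (hermite_coef k.+1 x c * hermite_coef k.+1 y e)) =
   (fun n => K / 2 * cos (c + e) * (\sum_(0 <= k < n) exp_coeff (- z) k.+1) +
     K / 2 * cos (c - e) * (\sum_(0 <= k < n) exp_coeff z k.+1)).
  apply/funext => n; rewrite !mulr_sumr -big_split /=; apply: eq_bigr => k _.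
  rewrite /exp_coeff /hermite_coef /K /= [(- z) ^+ _]exprNn /z !exprMn -signr_odd.
  rewrite cosD cosB /=.
  (* Half of [cos (c - e)] plus or minus half of [cos (c + e)] is the product of the cosines for
     even exponents and of the sines for odd ones. This is where each term factors. *)
  by case: (odd k); rewrite /= ?expr0 ?expr1; field;
     rewrite pnatr_eq0 -lt0n fact_gt0.
by apply: cvgD; apply: cvgMl_tmp; exact: cvg_exp_coeffS.
Qed.

End cosine_covariance_series.

(** * Covariances of trigonometric polynomials of a Gaussian pair *)

Section trig_covariance.
Context d (Omega : measurableType d) (R : realType) (P : probability Omega R).
Implicit Types (X Y : Omega -> R) (l : seq (R * R * R)).
Local Notation L2 := (Lfun P 2%:E).
Local Notation mean X := (fine 'E_P[X]).
Local Notation sd X := (Num.sqrt (fine 'V_P[X])).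

Lemma trig_poly_Lfun2 l X : measurable_fun setT X -> (fun w =>
    trig_poly l (X w)) \in L2.
Proof.
move=> mX; have [M lM] := trig_poly_bounded l.
apply: (@bounded_Lfun2 _ _ _ _ _ M) => //.
by apply: measurableT_comp mX; exact: trig_poly_measurable.
Qed.

Let cos_Lfun2 (c s : R) X : measurable_fun setT X -> (fun w =>
    cos (c + s * X w)) \in L2.
Proof.
move=> mX; apply: (@bounded_Lfun2 _ _ _ _ _ 1) => [|w]; last exact: cos_max.
exact: (measurableT_comp (cos_affine_measurable c s) mX).
Qed.

(** The product-to-sum formula reduces the mean of the product to the joint characteristic function
    at the frequencies [(s, t)] and [(s, - t)]. The numbers [x], [y], [c'], [e'] are the frequencies
    and phases after standardizing [X] and [Y], so that only the correlation remains. *)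
Let rcov_cos X Y (c s e t : R) :
  measurable_fun setT X -> measurable_fun setT Y -> bivariate_gaussian P X Y ->
  0 < fine 'V_P[X] -> 0 < fine 'V_P[Y] ->
  let x := s * sd X in let y := t * sd Y in
  let c' := c + s * mean X in let e' := e + t * mean Y in
  let r := correlation P X Y in
  rcov P (fun w => cos (c + s * X w)) (fun w => cos (e + t * Y w)) =
  (cos (c' + e') * expR (- ((x ^+ 2 + 2 * (r * x * y) + y ^+ 2) / 2)) +
   cos (c' - e') * expR (- ((x ^+ 2 - 2 * (r * x * y) + y ^+ 2) / 2))) / 2 -
  cos c' * expR (- (x ^+ 2 / 2)) * (cos e' * expR (- (y ^+ 2 / 2))).
Proof.
move=> mX mY XY VX VY x y c' e' r.
have [_ _ charac] := bivariate_gaussian_charac mX mY XY.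
have sX : sd X != 0 by rewrite gt_eqF// sqrtr_gt0.
have sY : sd Y != 0 by rewrite gt_eqF// sqrtr_gt0.
have x2 : x ^+ 2 = s ^+ 2 * fine 'V_P[X] by rewrite exprMn sqr_sqrtr// ltW.
have y2 : y ^+ 2 = t ^+ 2 * fine 'V_P[Y] by rewrite exprMn sqr_sqrtr// ltW.
have rxy : r * x * y = s * t * fine (covariance P X Y).
  by rewrite /r /correlation /x /y; field; rewrite sX sY.
have EX : \int[P]_w cos (c + s * X w) = cos c' * expR (- (x ^+ 2 / 2)).
  have := charac c s 0; rewrite x2 => H.
  rewrite -[LHS](_ : \int[P]_w cos (c + s * X w + 0 * Y w) = _).
    by rewrite H mul0r addr0; congr (_ * expR (- _)); ring.
  by apply: eq_Rintegral => w _; rewrite mul0r addr0.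
have EY : \int[P]_w cos (e + t * Y w) = cos e' * expR (- (y ^+ 2 / 2)).
  have := charac e 0 t; rewrite y2 => H.
  rewrite -[LHS](_ : \int[P]_w cos (e + 0 * X w + t * Y w) = _).
    by rewrite H mul0r addr0; congr (_ * expR (- _)); ring.
  by apply: eq_Rintegral => w _; rewrite mul0r addr0.
have icos (c0 s0 t0 : R) :
    P.-integrable setT (EFin \o (fun w => cos (c0 + s0 * X w + t0 * Y w))).
  apply: (@bounded_integrable _ _ _ P _ 1) => [|w]; last exact: cos_max.
  apply: measurableT_comp.
    by apply: continuous_measurable_fun; exact: continuous_cos.
  apply: measurable_funD; last exact: measurable_funM.
  by apply: measurable_funD => //; exact: measurable_funM.
have EXY : \int[P]_w (cos (c + s * X w) * cos (e + t * Y w)) =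
    (\int[P]_w cos ((c + e) + s * X w + t * Y w) +
     \int[P]_w cos ((c - e) + s * X w + (- t) * Y w)) / 2.
  rewrite -RintegralD// mulrC -RintegralZl//;
      last exact: (integrableD measurableT (icos _ _ _) (icos _ _ _)).
  apply: eq_Rintegral => w _.
  have -> : c + e + s * X w + t * Y w = (c + s * X w) + (e + t * Y w) by ring.
  have -> : c - e + s * X w + - t * Y w = (c + s * X w) - (e + t * Y w) by ring.
  by move: (c + s * X w) (e + t * Y w) => u v; rewrite cosD cosB; field.
rewrite rcovE ?cos_Lfun2// EX EY EXY !charac; congr ((_ * expR _ + _ * expR _) / 2 - _).
- by congr cos; rewrite /c' /e'; ring.
- by rewrite x2 y2 rxy; ring.
- by congr cos; rewrite /c' /e'; ring.
- by rewrite x2 y2 rxy; ring.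
Qed.

(** Linear extension of [hermite_coef] to the function [z |-> trig_poly l (m + s * z)], in which
    each cosine has frequency [t.2 * s] and phase [t.1.2 + t.2 * m]. *)
Definition trig_coef l (s m : R) (k : nat) : R :=
  \sum_(t <- l) t.1.1 * hermite_coef k (t.2 * s) (t.1.2 + t.2 * m).

Lemma cvg_trig_covariance X Y l l' :
  measurable_fun setT X -> measurable_fun setT Y -> bivariate_gaussian P X Y ->
  0 < fine 'V_P[X] -> 0 < fine 'V_P[Y] ->
  (\sum_(0 <= k < n) (correlation P X Y) ^+ k.+1 / k.+1`!%:R *
    (trig_coef l (sd X) (mean X) k.+1 * trig_coef l' (sd Y) (mean Y) k.+1) : R)
    @[n --> \oo] -->
  rcov P (fun w => trig_poly l (X w)) (fun w => trig_poly l' (Y w)).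
Proof.
move=> mX mY XY VX VY; set r := correlation P X Y.
rewrite /trig_poly rcov_sum; last 2 first.
- by move=> t; apply: Lfun2Z; exact: cos_Lfun2.
- by move=> t; apply: Lfun2Z; exact: cos_Lfun2.
have -> : (fun n => \sum_(0 <= k < n) r ^+ k.+1 / k.+1`!%:R *
    (trig_coef l (sd X) (mean X) k.+1 * trig_coef l' (sd Y) (mean Y) k.+1)) =
  (fun n => \sum_(t <- l) \sum_(u <- l') (t.1.1 * u.1.1) *
     \sum_(0 <= k < n) r ^+ k.+1 / k.+1`!%:R *
      (hermite_coef k.+1 (t.2 * sd X) (t.1.2 + t.2 * mean X) *
       hermite_coef k.+1 (u.2 * sd Y) (u.1.2 + u.2 * mean Y))).
  apply/funext => n.
  under [RHS]eq_bigr do under eq_bigr do rewrite mulr_sumr.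
  under [RHS]eq_bigr do rewrite exchange_big /=.
  rewrite [RHS]exchange_big /=; apply: eq_bigr => k _.
  rewrite /trig_coef mulr_suml mulr_sumr; apply: eq_bigr => t _.
  by rewrite !mulr_sumr; apply: eq_bigr => u _; ring.
apply: (@cvg_big R _ +%R 0 xpredT add_continuous) => t _.
apply: (@cvg_big R _ +%R 0 xpredT add_continuous) => u _.
rewrite rcovZl ?cos_Lfun2 ?Lfun2Z ?cos_Lfun2//.
rewrite rcovC rcovZl ?cos_Lfun2// rcovC mulrA.
by apply: cvgMl_tmp; rewrite rcov_cos//; exact: cvg_cos_covariance.
Qed.

End trig_covariance.

(** * The inequality for additive functions *)

Section correlation_inequality.
Context d (Omega : measurableType d) (R : realType) (P : probability Omega R).
Local Notation L2 := (Lfun P 2%:E).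

Lemma Rintegral_sum (I : Type) (r : seq I) (F : I -> Omega -> R) :
  (forall i, P.-integrable setT (EFin \o F i)) ->
  P.-integrable setT (EFin \o (fun w => \sum_(i <- r) F i w)) /\
  \int[P]_w (\sum_(i <- r) F i w) = \sum_(i <- r) \int[P]_w F i w.
Proof.
move=> iF; elim: r => [|i r [IH1 IH2]].
  split.
    under eq_fun do rewrite big_nil.
    exact: finite_measure_integrable_cst.
  under eq_Rintegral do rewrite big_nil.
  by rewrite big_nil Rintegral_cst// mul0r.
split.
  under eq_fun do rewrite big_cons.
  exact: (integrableD measurableT (iF i) IH1).
under eq_Rintegral do rewrite big_cons.
by rewrite big_cons RintegralD// IH2.
Qed.

Variables (p : nat) (Z : 'I_p -> Omega -> R).
Hypothesis mZ : forall i, measurable_fun setT (Z i).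
Hypothesis hZ : pairwise_gaussian P Z.
Hypothesis VZ : forall i, 0 < fine 'V_P[Z i].
Let S := correlation_mx P Z.
Let sd i := Num.sqrt (fine 'V_P[Z i]).

Let sd_neq0 i : sd i != 0.
Proof. by rewrite gt_eqF// sqrtr_gt0. Qed.

Let Z_Lfun2 i : Z i \in L2.
Proof. by have [] := bivariate_gaussian_charac (mZ i) (mZ i) (hZ i i). Qed.

Lemma correlation_mx_sym : (correlation_mx P Z)^T = correlation_mx P Z.
Proof.
apply/matrixP => i j; rewrite !mxE /correlation covarianceC.
by rewrite [X in _ / X]mulrC.
Qed.

(** Positivity of the variance matters here: for a constant [Z i] the quotient would be [0 / 0],
    that is 0. *)
Let S_diag i : S i i = 1.
Proof.
rewrite /S mxE /correlation -expr2 sqr_sqrtr ?ltW// divff// gt_eqF//.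
exact: VZ.
Qed.

(* S is the Gram matrix of the standardized Z i, so the Hadamard product with S
   is an expectation of values of the quadratic form of C. *)
Lemma hadamard_correlation_psd (C : 'M[R]_p) :
  (forall x, 0 <= quad_form C x) ->
  forall x, 0 <= quad_form (\matrix_(i, j) (C i j * S i j)) x.
Proof.
move=> psd x; pose y i := x i / sd i.
pose D i w := Z i w - fine 'E_P[Z i].
have D2 i : D i \in L2.
  have -> : D i = (fun w => Z i w + (- fine 'E_P[Z i])) by [].
  by apply: Lfun2D; [exact: Z_Lfun2|exact: Lfun2_cst].
have DD i j : fine (covariance P (Z i) (Z j)) = \int[P]_w (D i w * D j w).
  by rewrite covariance.unlock expectation.unlock /D expectation.unlock.
have iDD i j : P.-integrable setT (EFin \o (fun w =>
    C i j * (y i * y j) * (D i w * D j w))).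
  have iD := Lfun2_mul_integrable (D2 i) (D2 j).
  exact: (integrableZl measurableT _ iD).
have -> : quad_form (\matrix_(i, j) (C i j * S i j)) x =
    \int[P]_w quad_form C (fun i => y i * D i w).
  transitivity (\int[P]_w \sum_i \sum_j C i j * (y i * y j) * (D i w * D j w));
      last first.
    apply: eq_Rintegral => w _; apply: eq_bigr => i _; apply: eq_bigr => j _.
    by move: (y i) (y j) (D i w) (D j w) => ? ? ? ?; ring.
  apply/esym/(etrans (Rintegral_sum _ (fun i => (Rintegral_sum _ (iDD i)).1)).2).
  apply: eq_bigr => i _.
  apply: (etrans (Rintegral_sum _ (iDD i)).2); apply: eq_bigr => j _.
  rewrite RintegralZl//; last exact: Lfun2_mul_integrable.
  rewrite -DD !mxE /correlation -/(sd i) -/(sd j) /y; field.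
  by rewrite !sd_neq0.
by apply: Rintegral_ge0 => w _; exact: psd.
Qed.

Variables a b : R.
Hypothesis psd_ab : forall x, 0 <= a * (\sum_i x i ^+ 2) + b * quad_form S x.

Let psd_power k x :
  0 <= a * (\sum_i x i ^+ 2) + b * \sum_i \sum_j S i j ^+ k.+1 * (x i * x j).
Proof.
(* The exponent is shifted so that [C 0] is the hypothesis [psd_ab]. A Hadamard product with [S]
   leaves [a%:M] unchanged and raises the exponent by one. *)
pose C m : 'M[R]_p := a%:M + \matrix_(i, j) (b * S i j ^+ m.+1).
have CE m y : quad_form (C m) y =
    a * (\sum_i y i ^+ 2) + b * \sum_i \sum_j S i j ^+ m.+1 * (y i * y j).
  rewrite quad_formD quad_form_scalar; congr (_ + _).
  rewrite /quad_form mulr_sumr; apply: eq_bigr => i _.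
  by rewrite mulr_sumr; apply: eq_bigr => j _; rewrite mxE -mulrA.
suff H m : forall y, 0 <= quad_form (C m) y by rewrite -CE.
elim: m => [|m IH] y.
  by rewrite CE; exact: psd_ab.
have := hadamard_correlation_psd IH y.
rewrite (_ : \matrix_(i, j) _ = C m.+1)//.
have Cij k' i j : C k' i j = a *+ (i == j) + b * S i j ^+ k'.+1.
  by rewrite mxE [X in X + _ = _]mxE [X in _ + X = _]mxE.
apply/matrixP => i j; rewrite [LHS]mxE !Cij mulrDl -mulrA -exprSr; congr (_ + _).
have [->|ij] := eqVneq i j; first by rewrite S_diag mulr1.
by rewrite !mulr0n mul0r.
Qed.

Let trig_inequality (l : 'I_p -> seq (R * R * R)) :
  0 <= a * (\sum_i rcov P (fun w => trig_poly (l i) (Z i w))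
                         (fun w => trig_poly (l i) (Z i w))) +
       b * \sum_i \sum_j rcov P (fun w => trig_poly (l i) (Z i w))
                                 (fun w => trig_poly (l j) (Z j w)).
Proof.
pose A i w := trig_poly (l i) (Z i w); rewrite -/A.
pose be i k := trig_coef (l i) (sd i) (fine 'E_P[Z i]) k.+1.
pose cv i j n : R := \sum_(0 <= k < n) S i j ^+ k.+1 / k.+1`!%:R * (be i k * be j k).
have cvE i j : cv i j n @[n --> \oo] --> rcov P (A i) (A j).
  have -> : cv i j = (fun n => \sum_(0 <= k < n) correlation P (Z i) (Z j) ^+ k.+1 /
      k.+1`!%:R * (be i k * be j k)).
    by apply/funext => n; apply: eq_bigr => k _; rewrite /S mxE.
  exact: cvg_trig_covariance.
have cF : (a * (\sum_i cv i i n) + b * \sum_i \sum_j cv i j n : R) @[n --> \oo] -->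
    a * (\sum_i rcov P (A i) (A i)) + b * \sum_i \sum_j rcov P (A i) (A j).
  apply: cvgD; apply: cvgMl_tmp.
    by apply: (@cvg_big R _ +%R 0 xpredT add_continuous) => i _.
  apply: (@cvg_big R _ +%R 0 xpredT add_continuous) => i _.
  by apply: (@cvg_big R _ +%R 0 xpredT add_continuous) => j _.
apply: (cvgr_to_ge cF); apply: nearW => n.
have -> : a * (\sum_i cv i i n) + b * (\sum_i \sum_j cv i j n) =
    \sum_(0 <= k < n) k.+1`!%:R^-1 * (a * (\sum_i be i k ^+ 2) +
      b * \sum_i \sum_j S i j ^+ k.+1 * (be i k * be j k)).
  under [RHS]eq_bigr do rewrite mulrDr.
  rewrite big_split /=; congr (_ + _).
    under [RHS]eq_bigr do rewrite mulrCA mulr_sumr.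
    rewrite -mulr_sumr exchange_big /=; congr (_ * _); apply: eq_bigr => i _.
    by apply: eq_bigr => k _; rewrite S_diag expr1n mul1r expr2.
  under [RHS]eq_bigr do rewrite mulrCA mulr_sumr.
  rewrite -mulr_sumr [X in _ = _ * X]exchange_big /=; congr (_ * _);
      apply: eq_bigr => i _.
  under [RHS]eq_bigr do rewrite mulr_sumr.
  rewrite [RHS]exchange_big /=; apply: eq_bigr => j _.
  by apply: eq_bigr => k _; rewrite [RHS]mulrA [k.+1`!%:R^-1 * _]mulrC.
by apply: sumr_ge0 => k _; rewrite mulr_ge0 ?invr_ge0 ?psd_power.
Qed.

(** Every [g i] is approximated within [harmonic n ^+ 2], the rate required by [cvg_rcov]; a finite
    combination of covariances then converges, and nonnegativity passes to the limit. *)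
Lemma additive_inequality (g : 'I_p -> R -> R) :
  (forall i, measurable_fun setT (g i)) -> (forall i, g i \o Z i \in L2) ->
  0 <= a * (\sum_i rcov P (g i \o Z i) (g i \o Z i)) +
       b * \sum_i \sum_j rcov P (g i \o Z i) (g j \o Z j).
Proof.
move=> mg g2.
have h0 n : 0 < (harmonic n : R) ^+ 2 by rewrite exprn_gt0// /harmonic /= invr_gt0.
pose l n i := sval (cid (trig_approx_Lfun2 (mZ i) (mg i) (g2 i) (h0 n))).
pose A n i w := trig_poly (l n i) (Z i w).
have A2 n i : A n i \in L2 by exact: trig_poly_Lfun2.
have cA i n : (\int[P]_w ((A n i w - (g i \o Z i) w) ^+ 2)%:E <=
    (harmonic n ^+ 2)%:E)%E.
  rewrite /A /l; case: cid => l' /=; apply: le_trans.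
  by rewrite /sq_dist; under eq_integral do rewrite -sqrrN opprB.
have cR i j : rcov P (A n i) (A n j) @[n --> \oo] --> rcov P (g i \o Z i) (g j \o Z j).
  exact: cvg_rcov.
have cF : (a * (\sum_i rcov P (A n i) (A n i)) +
      b * \sum_i \sum_j rcov P (A n i) (A n j) : R) @[n --> \oo] -->
    a * (\sum_i rcov P (g i \o Z i) (g i \o Z i)) +
      b * \sum_i \sum_j rcov P (g i \o Z i) (g j \o Z j).
  apply: cvgD; apply: cvgMl_tmp.
    by apply: (@cvg_big R _ +%R 0 xpredT add_continuous) => i _.
  apply: (@cvg_big R _ +%R 0 xpredT add_continuous) => i _.
  by apply: (@cvg_big R _ +%R 0 xpredT add_continuous) => j _.
by apply: (cvgr_to_ge cF); apply: nearW => n; exact: trig_inequality.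
Qed.

End correlation_inequality.

(** * What finiteness and positivity of a variance imply *)

Section variance_facts.
Context d (Omega : measurableType d) (R : realType) (P : probability Omega R).

(** The variance is the integral of the square of [Y - c], where [c] is the [fine] part of the mean
    and hence a real number even before the mean is known to be finite. So [Y - c] is
    square-integrable, and [Y] differs from it by a constant. *)
Lemma variance_lty_Lfun2 (Y : Omega -> R) : measurable_fun setT Y ->
  ('V_P[Y] < +oo)%E -> Y \in Lfun P 2%:E.
Proof.
move=> mY; rewrite /variance covariance.unlock expectation.unlock.
set c := fine _ => Voo.
have mYc : measurable_fun setT (fun w => Y w + - c) by exact: measurable_funD.
have Yc2 : (fun w => Y w + - c) \in Lfun P 2%:E.
  by apply: Lfun2P => //; under eq_integral do rewrite expr2.
have -> : Y = (fun w => (Y w + - c) + c) by apply/funext => w; rewrite subrK.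
by apply: Lfun2D => //; exact: Lfun2_cst.
Qed.

(** If the variance of [Y] were 0, [Y] would be almost surely a constant [c] and [T \o Y] almost
    surely [T c], of variance 0. *)
Lemma variance_comp_gt0 (Y : Omega -> R) (T : R -> R) :
  Y \in Lfun P 2%:E -> measurable_fun setT T ->
  (0 < 'V_P[T \o Y])%E -> 0 < fine 'V_P[Y].
Proof.
move=> Y2 mT VT; have mY := Lfun2_measurable Y2.
rewrite lt_neqAle [X in _ && X](rvar_ge0 P Y) andbT eq_sym; apply/eqP => VY0.
have {VY0} : 'V_P[Y] = 0%E.
  by rewrite /variance EFin_rcov// -[X in X%:E]/(fine 'V_P[Y]) VY0.
rewrite /variance covariance.unlock expectation.unlock; set c := fine _ => V0.
have mD : measurable_fun setT (fun w => Y w - c) by exact: measurable_funB.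
have Yc : {ae P, forall w, Y w = c}.
  have /ae_eq_integral_abs H : measurable_fun setT
      (fun w => ((Y w - c) * (Y w - c))%:E).
    by apply/measurable_EFinP; exact: measurable_funM.
  have /H : (\int[P]_w `|((Y w - c) * (Y w - c))%:E| = 0)%E.
    rewrite -V0; apply: eq_integral => w _ /=.
    by rewrite ger0_norm// -expr2 sqr_ge0.
  move=> /(_ measurableT); apply: filterS => w /(_ I)/=[] /eqP.
  by rewrite mulf_eq0 orbb subr_eq0 => /eqP.
have TYc : {ae P, forall w, setT w -> ((T \o Y) w)%:E = (T c)%:E}.
  by apply: filterS Yc => w /= ->.
have mTY : measurable_fun setT (T \o Y) by exact: measurableT_comp.
have ETY : ('E_P[T \o Y] = (T c)%:E)%E.
  rewrite expectation.unlock (ae_eq_integral (cst (T c)%:E))//.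
  - by rewrite integral_cst// [X in (_ * X)%E]probability_setT mule1.
  - exact/measurable_EFinP.
move: VT; rewrite /variance covariance.unlock ETY /= expectation.unlock.
rewrite (ae_eq_integral (cst 0%E))//.
- by rewrite integral0 ltxx.
- apply/measurable_EFinP; apply: measurable_funM; exact: measurable_funB.
- by apply: filterS TYc => w /(_ I)/= [TYw] _; rewrite /= /GRing.mul/= TYw subrr mul0r.
Qed.

End variance_facts.

Local Open Scope ereal_scope.

Theorem corollary7 (d : measure_display) (Omega : measurableType d)
    (R : realType) (P : probability Omega R) (p : nat) (hp : (0 < p)%N)
    (Z : 'I_p -> {RV P >-> R}) (hZ : pairwise_gaussian P Z)
    (T : 'I_p -> R -> R) (mT : forall j, measurable_fun setT (T j))
    (hT : forall j, 0 < 'V_P[T j \o Z j] < +oo)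
    (X : 'I_p -> Omega -> R) (hX : forall j, X j = T j \o Z j)
    (f fhat : 'I_p -> R -> R)
    (mf : forall i, measurable_fun setT (f i))
    (mfhat : forall i, measurable_fun setT (fhat i))
    (hf : forall i, 'V_P[f i \o X i] < +oo)
    (hfhat : forall i, 'V_P[fhat i \o X i] < +oo) :
  (lambda_min (correlation_mx P Z))%:E *
    (\sum_(i < p) L20_seminorm P X (fun x => fhat i (x i) - f i (x i))%R ^+ 2)
    <= L20_seminorm P X
         (fun x => \sum_(i < p) fhat i (x i) - \sum_(i < p) f i (x i))%R ^+ 2
  /\
  L20_seminorm P X
      (fun x => \sum_(i < p) fhat i (x i) - \sum_(i < p) f i (x i))%R ^+ 2
    <= (lambda_max (correlation_mx P Z))%:E *
       (\sum_(i < p) L20_seminorm P X (fun x => fhat i (x i) - f i (x i))%R ^+ 2).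
Proof.
pose g i x := (fhat i (T i x) - f i (T i x))%R.
have mg i : measurable_fun setT (g i).
  by apply: measurable_funB; exact: measurableT_comp.
have mZ i : measurable_fun setT (Z i) by exact: measurable_funP.
have mX i : measurable_fun setT (X i) by rewrite hX; exact: measurableT_comp.
(* Square-integrability makes every variance below finite, so that both extended-real inequalities
   reduce to inequalities between real numbers. *)
have g2 i : g i \o Z i \in Lfun P 2%:E.
  have fh2 : fhat i \o X i \in Lfun P 2%:E.
    by apply: variance_lty_Lfun2 => //; exact: measurableT_comp.
  have f2 : f i \o X i \in Lfun P 2%:E.
    by apply: variance_lty_Lfun2 => //; exact: measurableT_comp.
  rewrite (_ : g i \o Z i = (fun w => (fhat i \o X i) w + -1 * (f i \o X i) w)%R).
    by apply: Lfun2D => //; exact: Lfun2Z.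
  by apply/funext => w; rewrite /g /= hX mulN1r.
have VZ i : (0 < fine 'V_P[Z i])%R.
  have [Z2 _ _] := bivariate_gaussian_charac (mZ i) (mZ i) (hZ i i).
  by apply: (@variance_comp_gt0 _ _ _ _ _ (T i)) => //; have /andP[] := hT i.
have seminorm_sum : \sum_(i < p) L20_seminorm P X (fun x =>
    fhat i (x i) - f i (x i))%R ^+ 2
    = (\sum_(i < p) rcov P (g i \o Z i) (g i \o Z i))%:E.
  rewrite -sumEFin; apply: eq_bigr => i _.
  rewrite /L20_seminorm sqr_sqrte ?variance_ge0//.
  rewrite (_ : (fun w => _) = g i \o Z i); first exact: EFin_rcov.
  by apply/funext => w; rewrite /g /= hX.
have sum_seminorm : L20_seminorm P X
      (fun x => \sum_(i < p) fhat i (x i) - \sum_(i < p) f i (x i))%R ^+ 2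
    = (\sum_(i < p) \sum_(j < p) rcov P (g i \o Z i) (g j \o Z j))%:E.
  rewrite /L20_seminorm sqr_sqrte ?variance_ge0//.
  rewrite (_ : (fun w => _) = (fun w => \sum_(i < p) (g i \o Z i) w)%R); last first.
    by apply/funext => w; rewrite -sumrB; apply: eq_bigr => i _; rewrite /g /= hX.
  by rewrite /variance EFin_rcov ?rcov_sum//; exact: Lfun2_sum.
rewrite seminorm_sum sum_seminorm -!EFinM !lee_fin.
have sS := correlation_mx_sym P Z.
split; rewrite -subr_ge0.
- have psd x : (0 <= - lambda_min (correlation_mx P Z) * (\sum_i x i ^+ 2) +
      1 * quad_form (correlation_mx P Z) x)%R.
    by rewrite mul1r mulNr addrC subr_ge0; exact: lambda_min_quad_form.
  have := additive_inequality mZ hZ VZ psd mg g2.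
  by rewrite mul1r mulNr addrC.
- have psd x : (0 <= lambda_max (correlation_mx P Z) * (\sum_i x i ^+ 2) +
      -1 * quad_form (correlation_mx P Z) x)%R.
    by rewrite mulN1r subr_ge0; exact: lambda_max_quad_form.
  have := additive_inequality mZ hZ VZ psd mg g2.
  by rewrite mulN1r.
Qed.
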